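(* Consider the generalized Riemann problem described in the context, with the local wave configuration described there (a left rarefaction wave associated with $\lambda_-$, an intermediate region, and a right shock wave). Then the limiting values $\left(\frac{\partial\rho}{\partial t}\right)_*$ and $\left(\frac{\partial v}{\partial t}\right)_*$ satisfy $$a_L\left(\frac{\partial\rho}{\partial t}\right)_*+b_L\left(\frac{\partial v}{\partial t}\right)_*=d_L,$$ where $$a_L=\left(\frac{c_s}{\rho+p}\right)_*,\qquad b_L=\left(\frac{1}{1-v^2}\right)_*,$$ and $$\begin{aligned}d_L=&\left(\frac{\lambda_+}{\lambda_+-\lambda_-}\right)_*\left(\frac{D_-\psi_-}{Dt}\right)_L\exp\left(-\int_{\beta_L}^{\beta_*}\frac{d\hat\beta}{\lambda_+(0,\hat\beta)-\lambda_-(0,\hat\beta)}\right)-\left(\frac{\lambda_-s_-}{\lambda_+-\lambda_-}\right)_*\\&+\left(\frac{\lambda_+}{\lambda_+-\lambda_-}\right)_*\int_{\beta_L}^{\beta_*}\left(\frac{s_-}{\lambda_+-\lambda_-}\right)(0,\hat\beta)\exp\left(-\int_{\hat\beta}^{\beta_*}\frac{d\omega}{\lambda_+(0,\omega)-\lambda_-(0,\omega)}\right)d\hat\beta .\end{aligned}$$ Here $d_L$ is a function of the initial data $\mathbf U_L,\mathbf U_L'$ and of the limiting values $\mathbf U_*$, respectively the solution $\boldsymbol\omega((r-r_0)/t;\mathbf U_L,\mathbf U_R)$ of the associated classical Riemann problem.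
   Context: **Equations.** Units are such that the speed of light and Newton's constant equal $1$; $\kappa$ is the (constant) Einstein coupling constant. The fluid has rest energy density $\rho>0$, velocity $v\in(-1,1)$ and pressure $p=p(\rho)\ge 0$, where $p$ is a sufficiently smooth function with $0<p'(\rho)<1$; $c_s=\sqrt{p'(\rho)}$ and $W=1/\sqrt{1-v^2}$. The metric functions $A(t,r)>0$, $B(t,r)>0$ are locally Lipschitz continuous. With $\mathcal T^{00}=(\rho+p)W^2-p$, $\mathcal T^{01}=(\rho+p)W^2v$, $\mathcal T^{11}=(\rho v^2+p)W^2$, $\mathbf U=(\mathcal T^{00},\mathcal T^{01})^{T}$, $\mathbf F(\mathbf U)=(\mathcal T^{01},\mathcal T^{11})^{T}$, the spherically symmetric general relativistic hydrodynamics system is $$\partial_t\mathbf U+\partial_r\big(\sqrt{AB}\,\mathbf F(\mathbf U)\big)=\mathbf S,\quad \partial_rM=\tfrac12\kappa r^2\mathcal T^{00},\quad \frac1B\partial_rB=\frac{1-A}{Ar}+\frac{\kappa r}{A}\mathcal T^{11},\quad A=1-\frac{2M}{r},$$ $$\mathbf S=-\sqrt{AB}\Big(\tfrac2r\mathcal T^{01},\ \tfrac2r\mathcal T^{11}+\tfrac{1-A}{2Ar}(\mathcal T^{00}-\mathcal T^{11})+\tfrac{\kappa r}{A}\big(\mathcal T^{00}\mathcal T^{11}-(\mathcal T^{01})^2\big)-\tfrac{2p}{r}\Big)^{T}.$$ In smooth regions, the primitive vector $\mathbf V=(\rho,v)^T$ satisfies $\partial_t\mathbf V+\mathbf J\,\partial_r\mathbf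 V=\mathbf H=(H_1,H_2)^T$, where $$\mathbf J=\frac{\sqrt{AB}}{1-v^2c_s^2}\begin{pmatrix}v(1-c_s^2)&\rho+p\\ \frac{(1-v^2)^2c_s^2}{\rho+p}&v(1-c_s^2)\end{pmatrix},$$ $$H_1=-\frac{\sqrt{AB}}{r(1-v^2c_s^2)}\,2v(\rho+p)\Big(1-\frac{\kappa r^2(\rho+p)}{4A}\Big),$$ $$H_2=-\frac{\sqrt{AB}\,(1-v^2)}{r(1-v^2c_s^2)}\Big(-2v^2c_s^2+\frac{(1-A)(1-v^2c_s^2)}{2A}+\frac{\kappa r^2(p+\rho v^2c_s^2)}{2A}\Big).$$ **Characteristics and Riemann invariants.** The characteristic speeds are $\lambda_\pm=\sqrt{AB}\,\frac{v\pm c_s}{1\pm vc_s}$, and $\frac{D_\pm}{Dt}=\partial_t+\lambda_\pm\partial_r$. The Riemann invariants are $\psi_\pm=\frac12\ln\frac{1+v}{1-v}\mp\int^{\rho}\frac{\sqrt{p'(\omega)}}{\omega+p(\omega)}d\omega$. In smooth regions $\frac{D_\pm\psi_\mp}{Dt}=s_\mp$, where $s_\mp:=\frac{1}{1-v^2}H_2\pm\frac{c_s}{\rho+p}H_1$. **Generalized Riemann problem (GRP).** Fix $r_0>0$ and constant vectors $\mathbf U_L,\mathbf U_R,\mathbf U_L',\mathbf U_R'$. The initial data are $\mathbf U(0,r)=\mathbf U_L+(r-r_0)\mathbf U_L'$ for $r<r_0$ and $\mathbf U_R+(r-r_0)\mathbf U_R'$ for $r>r_0$. The associated classical Riemann problem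 is $\partial_t\mathbf U+\sqrt{A_*B_*}\,\partial_r\mathbf F(\mathbf U)=0$ with data $\mathbf U_L$ ($r<r_0$), $\mathbf U_R$ ($r>r_0$), where $A_*=A(0,r_0)$, $B_*=B(0,r_0)$; its self-similar solution is $\boldsymbol\omega((r-r_0)/t;\mathbf U_L,\mathbf U_R)$, and the GRP solution satisfies $\lim_{t\to0^+}\mathbf U(t,r_0+t\lambda)=\boldsymbol\omega(\lambda;\mathbf U_L,\mathbf U_R)$. **Wave configuration.** For small $t>0$ the GRP solution consists of a smooth left region (state $\mathbf U_L(t,r)$), a curved rarefaction wave associated with $\lambda_-$ centered at $(0,r_0)$, a smooth intermediate region (state $\mathbf U_*(t,r)$) containing the line $r=r_0$, a shock associated with $\lambda_+$ moving to the right, and a smooth right region. The solution is continuous across the two $\lambda_-$-characteristics bounding the rarefaction wave. For a quantity $V$ (a state variable or one of its derivatives), $V_L$, $V_R$ are its limits at $(0,r_0)$ as $t\to0^+$ from the left and right regions, and $V_*$ its limit as $t\to0^+$ from the intermediate region; $A$, $B$, $r$ take the values $A_*,B_*,r_0$ in these limits. In particular $\left(\frac{D_-\psi_-}{Dt}\right)_L$ is the limit of $\frac{D_-\psi_-}{Dt}$ from the left region, which is computed from $\mathbf U_L,\mathbf U_L'$ via the primitive system. **Characteristic coordinates in the rarefaction wave.** Let $\beta_L=\lambda_-(\mathbf U_L)$, $\beta_*=\lambda_-(\mathbf U_* )$. The rarefaction region is described by coordinates $(\alpha,\beta)$, $\beta\in[\beta_L,\beta_*]$, $\alpha\le0$,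 whose level curves $\beta=$ const and $\alpha=$ const are the integral curves of $\frac{dr}{dt}=\lambda_-$ and $\frac{dr}{dt}=\lambda_+$, respectively; $\beta$ is the initial slope $\lambda_-$ of the curve at the singular point $(0,r_0)$, and $\alpha+r_0$ is the $r$-coordinate of the intersection of the transversal $\lambda_+$-curve with the leading curve $\beta=\beta_L$. All quantities in the fan are regarded as (sufficiently smooth, up to $\alpha=0$) functions of $(\alpha,\beta)$; $\alpha=0$ corresponds to $(t,r)=(0,r_0)$, so $Q(0,\beta)$ denotes the limit of $Q$ at the singular point along the $\lambda_-$-characteristic with initial slope $\beta$, and $\mathbf U(0,\beta)$ is the state of the centered rarefaction fan of the classical Riemann problem with $\lambda_-(0,\beta)=\beta$. *)

(* Defs.v *)
From Stdlib Require Import Reals.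
From Coquelicot Require Import Coquelicot.
Open Scope R_scope.

(** * Fields on the (t, r) half-plane: derivatives, limits, regularity *)

Definition D1 (f : R -> R -> R) (x y : R) : R := Derive (fun s => f s y) x.
Definition D2 (f : R -> R -> R) (x y : R) : R := Derive (fun s => f x s) y.

Definition uncurry (f : R -> R -> R) (q : R * R) : R := f (fst q) (snd q).

(** [f] tends to [l] at the point [P], approached from inside the set [Om]. *)
Definition tends (Om : R * R -> Prop) (f : R -> R -> R) (P : R * R) (l : R) : Prop :=
  filterlim (uncurry f) (within Om (locally P)) (locally l).

Definition C1_at (f : R -> R -> R) (q : R * R) : Prop :=
  ex_derive (fun s => f s (snd q)) (fst q) /\
  ex_derive (fun s => f (fst q) s) (snd q) /\
  continuous (uncurry (D1 f)) q /\ continuous (uncurry (D2 f)) q.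

Definition C1_on (Om : R * R -> Prop) (f : R -> R -> R) : Prop :=
  forall q, Om q -> C1_at f q.

(** C^2 up to the boundary of a set [K] with boundary: [f] is C^2 in a
    neighbourhood of every point of [K].  Values of [f] outside [K] are an
    arbitrary smooth extension. *)
Definition C2_upto (K : R * R -> Prop) (f : R -> R -> R) : Prop :=
  forall q, K q ->
    locally q (fun z => C1_at f z /\ C1_at (D1 f) z /\ C1_at (D2 f) z).

Definition locally_lipschitz_on (K : R * R -> Prop) (f : R -> R -> R) : Prop :=
  forall q, K q -> exists eps L : R, 0 < eps /\
    forall x y : R * R, K x -> K y -> ball q eps x -> ball q eps y ->
      Rabs (uncurry f x - uncurry f y)
        <= L * (Rabs (fst x - fst y) + Rabs (snd x - snd y)).

(** * The fluid *)

Definition eos (p : R -> R) : Prop :=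
  forall x, 0 < x ->
    0 <= p x /\ ex_derive p x /\ 0 < Derive p x < 1 /\
    ex_derive (Derive p) x /\ continuous (Derive (Derive p)) x.

Definition physical (rho v : R) : Prop := 0 < rho /\ -1 < v < 1.

Definition cs (p : R -> R) (rho : R) : R := sqrt (Derive p rho).
Definition W (v : R) : R := 1 / sqrt (1 - v ^ 2).

Definition T00 (p : R -> R) (rho v : R) : R := (rho + p rho) * W v ^ 2 - p rho.
Definition T01 (p : R -> R) (rho v : R) : R := (rho + p rho) * W v ^ 2 * v.
Definition T11 (p : R -> R) (rho v : R) : R := (rho * v ^ 2 + p rho) * W v ^ 2.

Definition consU (p : R -> R) (rho v : R) : R * R := (T00 p rho v, T01 p rho v).

Definition S0 (p : R -> R) (A B r rho v : R) : R :=
  - sqrt (A * B) * (2 / r * T01 p rho v).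
Definition S1 (p : R -> R) (kappa A B r rho v : R) : R :=
  - sqrt (A * B) *
    (2 / r * T11 p rho v
     + (1 - A) / (2 * A * r) * (T00 p rho v - T11 p rho v)
     + kappa * r / A * (T00 p rho v * T11 p rho v - T01 p rho v ^ 2)
     - 2 * p rho / r).

(** ** Primitive form  V_t + J V_r = H,  V = (rho, v) *)

Definition Jpref (p : R -> R) (A B rho v : R) : R :=
  sqrt (A * B) / (1 - v ^ 2 * cs p rho ^ 2).
(** The two diagonal entries of J coincide. *)
Definition Jdiag (p : R -> R) (A B rho v : R) : R :=
  Jpref p A B rho v * (v * (1 - cs p rho ^ 2)).
Definition J12 (p : R -> R) (A B rho v : R) : R :=
  Jpref p A B rho v * (rho + p rho).
Definition J21 (p : R -> R) (A B rho v : R) : R :=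
  Jpref p A B rho v * ((1 - v ^ 2) ^ 2 * cs p rho ^ 2 / (rho + p rho)).

Definition H1 (p : R -> R) (kappa A B r rho v : R) : R :=
  - (sqrt (A * B) / (r * (1 - v ^ 2 * cs p rho ^ 2)))
  * (2 * v * (rho + p rho))
  * (1 - kappa * r ^ 2 * (rho + p rho) / (4 * A)).
Definition H2 (p : R -> R) (kappa A B r rho v : R) : R :=
  - (sqrt (A * B) * (1 - v ^ 2) / (r * (1 - v ^ 2 * cs p rho ^ 2)))
  * (- 2 * v ^ 2 * cs p rho ^ 2
     + (1 - A) * (1 - v ^ 2 * cs p rho ^ 2) / (2 * A)
     + kappa * r ^ 2 * (p rho + rho * v ^ 2 * cs p rho ^ 2) / (2 * A)).

(** ** Characteristics and Riemann invariants *)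

Definition lam_plus (p : R -> R) (A B rho v : R) : R :=
  sqrt (A * B) * ((v + cs p rho) / (1 + v * cs p rho)).
Definition lam_minus (p : R -> R) (A B rho v : R) : R :=
  sqrt (A * B) * ((v - cs p rho) / (1 - v * cs p rho)).

(** [rho_ref] is the (arbitrary) base point of the indefinite integral. *)
Definition psi_minus (p : R -> R) (rho_ref rho v : R) : R :=
  1 / 2 * ln ((1 + v) / (1 - v))
  + RInt (fun w => sqrt (Derive p w) / (w + p w)) rho_ref rho.

Definition s_minus (p : R -> R) (kappa A B r rho v : R) : R :=
  1 / (1 - v ^ 2) * H2 p kappa A B r rho v
  + cs p rho / (rho + p rho) * H1 p kappa A B r rho v.

(** * Solutions of the coupled system *)

Record flow := Flow {
  f_rho : R -> R -> R;
  f_v : R -> R -> R;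
  f_A : R -> R -> R;
  f_B : R -> R -> R;
  f_M : R -> R -> R }.

Definition fT (T : (R -> R) -> R -> R -> R) (p : R -> R) (Q : flow) (t r : R) : R :=
  T p (f_rho Q t r) (f_v Q t r).

Definition fsqrtAB (Q : flow) (t r : R) : R := sqrt (f_A Q t r * f_B Q t r).

Definition flam_plus (p : R -> R) (Q : flow) (t r : R) : R :=
  lam_plus p (f_A Q t r) (f_B Q t r) (f_rho Q t r) (f_v Q t r).
Definition flam_minus (p : R -> R) (Q : flow) (t r : R) : R :=
  lam_minus p (f_A Q t r) (f_B Q t r) (f_rho Q t r) (f_v Q t r).

(** D_- psi_- / Dt *)
Definition Dminus_psi_minus (p : R -> R) (rho_ref : R) (Q : flow) (t r : R) : R :=
  let psi := fun t' r' => psi_minus p rho_ref (f_rho Q t' r') (f_v Q t' r') in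
  D1 psi t r + flam_minus p Q t r * D2 psi t r.

(** Classical solution of the balance laws and constraints in an open set. *)
Record classical_solution (p : R -> R) (kappa : R) (Q : flow)
    (Om : R * R -> Prop) : Prop := {
  cl_rho : C1_on Om (f_rho Q);
  cl_v : C1_on Om (f_v Q);
  cl_M : forall t r, Om (t, r) ->
    is_derive (fun x => f_M Q t x) r (1 / 2 * kappa * r ^ 2 * fT T00 p Q t r);
  cl_B : forall t r, Om (t, r) ->
    ex_derive (fun x => f_B Q t x) r /\
    1 / f_B Q t r * D2 (f_B Q) t r
      = (1 - f_A Q t r) / (f_A Q t r * r) + kappa * r / f_A Q t r * fT T11 p Q t r;
  cl_energy : forall t r, Om (t, r) ->
    D1 (fT T00 p Q) t r + D2 (fun t' r' => fsqrtAB Q t' r' * fT T01 p Q t' r') t r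
      = S0 p (f_A Q t r) (f_B Q t r) r (f_rho Q t r) (f_v Q t r);
  cl_momentum : forall t r, Om (t, r) ->
    D1 (fT T01 p Q) t r + D2 (fun t' r' => fsqrtAB Q t' r' * fT T11 p Q t' r') t r
      = S1 p kappa (f_A Q t r) (f_B Q t r) r (f_rho Q t r) (f_v Q t r) }.

(** The state tends to (rho0, v0) and its first derivatives have limits at [P] from
    inside [Om]. *)
Definition C1_limits (Q : flow) (Om : R * R -> Prop) (P : R * R) (rho0 v0 : R) : Prop :=
  tends Om (f_rho Q) P rho0 /\ tends Om (f_v Q) P v0 /\
  (exists l, tends Om (D1 (f_rho Q)) P l) /\ (exists l, tends Om (D2 (f_rho Q)) P l) /\
  (exists l, tends Om (D1 (f_v Q)) P l) /\ (exists l, tends Om (D2 (f_v Q)) P l).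

(** Rankine-Hugoniot conditions for U_t + (C F(U))_r at a jump of speed [sig]
    from (rho1, v1) on the left to (rho2, v2) on the right. *)
Definition rankine_hugoniot (p : R -> R) (C sig rho1 v1 rho2 v2 : R) : Prop :=
  sig * (T00 p rho2 v2 - T00 p rho1 v1) = C * (T01 p rho2 v2 - T01 p rho1 v1) /\
  sig * (T01 p rho2 v2 - T01 p rho1 v1) = C * (T11 p rho2 v2 - T11 p rho1 v1).

(** Lax conditions for a shock of the lambda_+ family. *)
Definition lax_plus (p : R -> R) (A B sig rho1 v1 rho2 v2 : R) : Prop :=
  lam_plus p A B rho2 v2 < sig < lam_plus p A B rho1 v1 /\
  lam_minus p A B rho1 v1 < sig.

(** * The classical Riemann problem: lambda_- rarefaction, lambda_+ shock *)

(** [wrho], [wv] are the primitive components of the self-similar solution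
    omega(lambda).  Its value at the shock speed [sig] is left unspecified. *)
Record riemann_solution (p : R -> R) (As Bs rhoL vL rhoR vR : R)
    (wrho wv : R -> R) (rhoS vS sig : R) : Prop := {
  rs_phys : forall x, x <> sig -> physical (wrho x) (wv x);
  rs_order : lam_minus p As Bs rhoL vL < lam_minus p As Bs rhoS vS < sig;
  rs_left : forall x, x <= lam_minus p As Bs rhoL vL -> wrho x = rhoL /\ wv x = vL;
  rs_mid : forall x, lam_minus p As Bs rhoS vS <= x < sig -> wrho x = rhoS /\ wv x = vS;
  rs_right : forall x, sig < x -> wrho x = rhoR /\ wv x = vR;
  rs_cont : forall x,
    lam_minus p As Bs rhoL vL <= x <= lam_minus p As Bs rhoS vS ->
    continuous wrho x /\ continuous wv x;
  rs_fan_speed : forall x,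
    lam_minus p As Bs rhoL vL <= x <= lam_minus p As Bs rhoS vS ->
    lam_minus p As Bs (wrho x) (wv x) = x;
  (** The self-similar equation  - x U' + sqrt(As Bs) F(U)' = 0. *)
  rs_fan_ode : forall x,
    lam_minus p As Bs rhoL vL < x < lam_minus p As Bs rhoS vS ->
    ex_derive wrho x /\ ex_derive wv x /\
    - x * Derive (fun y => T00 p (wrho y) (wv y)) x
      + sqrt (As * Bs) * Derive (fun y => T01 p (wrho y) (wv y)) x = 0 /\
    - x * Derive (fun y => T01 p (wrho y) (wv y)) x
      + sqrt (As * Bs) * Derive (fun y => T11 p (wrho y) (wv y)) x = 0;
  rs_shock : rankine_hugoniot p (sqrt (As * Bs)) sig rhoS vS rhoR vR;
  rs_lax : lax_plus p As Bs sig rhoS vS rhoR vR }.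

(** * The generalized Riemann problem and its local wave configuration *)

Definition dom (r0 T delta : R) (q : R * R) : Prop :=
  0 <= fst q < T /\ r0 - delta < snd q < r0 + delta.

(** The open region between the curves [c1] and [c2]. *)
Definition between (T : R) (c1 c2 : R -> R) (q : R * R) : Prop :=
  0 < fst q < T /\ c1 (fst q) < snd q < c2 (fst q).

Definition left_region (r0 T delta : R) (chiL : R -> R) : R * R -> Prop :=
  between T (fun _ => r0 - delta) chiL.
Definition right_region (r0 T delta : R) (shock : R -> R) : R * R -> Prop :=
  between T shock (fun _ => r0 + delta).

(** [chiL], [chiS] bound the rarefaction wave, [shock] is the shock curve.
    [UL], [UR], [UL'], [UR'] are the data in conserved variables. *)
Record grp_solution (p : R -> R) (kappa r0 : R) (UL UR UL' UR' : R * R)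
    (rhoL vL rhoR vR : R) (wrho wv : R -> R) (rhoS vS sig : R)
    (Q : flow) (T delta : R) (chiL chiS shock : R -> R) : Prop := {
  gs_T : 0 < T;
  gs_delta : 0 < delta <= r0;

  gs_phys : forall t r, dom r0 T delta (t, r) -> physical (f_rho Q t r) (f_v Q t r);
  gs_metric : forall t r, dom r0 T delta (t, r) ->
    0 < f_A Q t r /\ 0 < f_B Q t r /\ f_A Q t r = 1 - 2 * f_M Q t r / r;
  gs_lipA : locally_lipschitz_on (dom r0 T delta) (f_A Q);
  gs_lipB : locally_lipschitz_on (dom r0 T delta) (f_B Q);

  gs_dataL : forall r, r0 - delta < r < r0 ->
    fT T00 p Q 0 r = fst UL + (r - r0) * fst UL' /\
    fT T01 p Q 0 r = snd UL + (r - r0) * snd UL';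
  gs_dataR : forall r, r0 < r < r0 + delta ->
    fT T00 p Q 0 r = fst UR + (r - r0) * fst UR' /\
    fT T01 p Q 0 r = snd UR + (r - r0) * snd UR';
  gs_cont0 : forall r, r0 - delta < r < r0 + delta -> r <> r0 ->
    tends (dom r0 T delta) (f_rho Q) (0, r) (f_rho Q 0 r) /\
    tends (dom r0 T delta) (f_v Q) (0, r) (f_v Q 0 r);

  gs_order : forall t, 0 < t < T ->
    r0 - delta < chiL t < chiS t /\ chiS t < r0 < shock t /\ shock t < r0 + delta;

  gs_left : classical_solution p kappa Q (left_region r0 T delta chiL);
  gs_fan : classical_solution p kappa Q (between T chiL chiS);
  gs_mid : classical_solution p kappa Q (between T chiS shock);
  gs_right : classical_solution p kappa Q (right_region r0 T delta shock);
  gs_left_lim : C1_limits Q (left_region r0 T delta chiL) (0, r0) rhoL vL;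
  gs_mid_lim : C1_limits Q (between T chiS shock) (0, r0) rhoS vS;
  gs_right_lim : C1_limits Q (right_region r0 T delta shock) (0, r0) rhoR vR;

  (** Continuity away from the shock, in particular across [chiL] and [chiS]. *)
  gs_cont : forall t r, 0 < t -> dom r0 T delta (t, r) -> r <> shock t ->
    continuous (uncurry (f_rho Q)) (t, r) /\ continuous (uncurry (f_v Q)) (t, r);

  gs_chiL0 : filterlim chiL (at_right 0) (locally r0);
  gs_chiS0 : filterlim chiS (at_right 0) (locally r0);
  gs_chiL : forall t, 0 < t < T -> is_derive chiL t (flam_minus p Q t (chiL t));
  gs_chiS : forall t, 0 < t < T -> is_derive chiS t (flam_minus p Q t (chiS t));

  gs_shock0 : filterlim shock (at_right 0) (locally r0);
  gs_shock_speed : 0 < sig /\ filterlim (Derive shock) (at_right 0) (locally sig);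
  gs_shock : forall t, 0 < t < T ->
    ex_derive shock t /\
    exists rho1 v1 rho2 v2 : R,
      physical rho1 v1 /\ physical rho2 v2 /\
      tends (between T chiS shock) (f_rho Q) (t, shock t) rho1 /\
      tends (between T chiS shock) (f_v Q) (t, shock t) v1 /\
      tends (right_region r0 T delta shock) (f_rho Q) (t, shock t) rho2 /\
      tends (right_region r0 T delta shock) (f_v Q) (t, shock t) v2 /\
      rankine_hugoniot p (fsqrtAB Q t (shock t)) (Derive shock t) rho1 v1 rho2 v2 /\
      lax_plus p (f_A Q t (shock t)) (f_B Q t (shock t)) (Derive shock t) rho1 v1 rho2 v2;

  gs_riemann_limit : forall x, x <> sig ->
    filterlim (fun t => fT T00 p Q t (r0 + t * x)) (at_right 0)
      (locally (T00 p (wrho x) (wv x))) /\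
    filterlim (fun t => fT T01 p Q t (r0 + t * x)) (at_right 0)
      (locally (T01 p (wrho x) (wv x))) }.

(** * Characteristic coordinates in the rarefaction wave *)

(** t, r and the quantities in the fan as functions of (alpha, beta). *)
Record fan_chart := FanChart {
  c_t : R -> R -> R;
  c_r : R -> R -> R;
  c_rho : R -> R -> R;
  c_v : R -> R -> R;
  c_A : R -> R -> R;
  c_B : R -> R -> R }.

Definition clam_plus (p : R -> R) (c : fan_chart) (a b : R) : R :=
  lam_plus p (c_A c a b) (c_B c a b) (c_rho c a b) (c_v c a b).
Definition clam_minus (p : R -> R) (c : fan_chart) (a b : R) : R :=
  lam_minus p (c_A c a b) (c_B c a b) (c_rho c a b) (c_v c a b).

(** [a0 < alpha <= 0], [bL <= beta <= bS]. *)
Definition chart_dom (a0 bL bS : R) (q : R * R) : Prop :=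
  a0 < fst q <= 0 /\ bL <= snd q <= bS.

Record fan_coordinates (p : R -> R) (r0 : R) (wrho wv : R -> R) (bL bS : R)
    (Q : flow) (T : R) (chiL chiS : R -> R) (c : fan_chart) (a0 : R) : Prop := {
  fc_a0 : a0 < 0;

  fc_t : C2_upto (chart_dom a0 bL bS) (c_t c);
  fc_r : C2_upto (chart_dom a0 bL bS) (c_r c);
  fc_rho : C2_upto (chart_dom a0 bL bS) (c_rho c);
  fc_v : C2_upto (chart_dom a0 bL bS) (c_v c);
  fc_A : C2_upto (chart_dom a0 bL bS) (c_A c);
  fc_B : C2_upto (chart_dom a0 bL bS) (c_B c);

  (** alpha = 0 is the singular point, where the state is that of the
      centered fan of the classical Riemann problem. *)
  fc_origin : forall b, bL <= b <= bS -> c_t c 0 b = 0 /\ c_r c 0 b = r0;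
  fc_origin_state : forall b, bL <= b <= bS -> c_rho c 0 b = wrho b /\ c_v c 0 b = wv b;
  fc_origin_metric : forall b, bL <= b <= bS ->
    c_A c 0 b = f_A Q 0 r0 /\ c_B c 0 b = f_B Q 0 r0;

  (** alpha < 0 parametrizes the fan near the singular point bijectively. *)
  fc_state : forall a b, a0 < a < 0 -> bL <= b <= bS ->
    c_rho c a b = f_rho Q (c_t c a b) (c_r c a b) /\
    c_v c a b = f_v Q (c_t c a b) (c_r c a b) /\
    c_A c a b = f_A Q (c_t c a b) (c_r c a b) /\
    c_B c a b = f_B Q (c_t c a b) (c_r c a b);
  fc_into : forall a b, a0 < a < 0 -> bL < b < bS ->
    between T chiL chiS (c_t c a b, c_r c a b);
  fc_edges : forall a, a0 < a < 0 ->
    0 < c_t c a bL < T /\ c_r c a bL = chiL (c_t c a bL) /\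
    0 < c_t c a bS < T /\ c_r c a bS = chiS (c_t c a bS);
  fc_inj : forall a b a' b', a0 < a < 0 -> a0 < a' < 0 ->
    bL <= b <= bS -> bL <= b' <= bS ->
    c_t c a b = c_t c a' b' -> c_r c a b = c_r c a' b' -> a = a' /\ b = b';
  fc_onto : exists tau, 0 < tau /\
    forall t r, 0 < t < tau -> chiL t <= r <= chiS t ->
      exists a b, a0 < a < 0 /\ bL <= b <= bS /\ c_t c a b = t /\ c_r c a b = r;

  (** beta = const are lambda_- curves, alpha = const are lambda_+ curves. *)
  fc_minus : forall a b, a0 < a < 0 -> bL <= b <= bS ->
    D1 (c_r c) a b = clam_minus p c a b * D1 (c_t c) a b;
  fc_plus : forall a b, a0 < a < 0 -> bL <= b <= bS ->
    D2 (c_r c) a b = clam_plus p c a b * D2 (c_t c) a b;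

  (** alpha + r0 is the r-coordinate on the leading curve beta = beta_L. *)
  fc_alpha : forall a, a0 < a < 0 -> c_r c a bL = r0 + a }.

(** * The coefficients *)

(** Slopes (rho', v') of the primitive variables at (rho, v) for which
    DU(rho, v) (rho', v') = U' (Cramer's rule). *)
Definition primitive_slope (p : R -> R) (rho v : R) (U' : R * R) : R * R :=
  let a11 := Derive (fun x => T00 p x v) rho in
  let a12 := Derive (fun y => T00 p rho y) v in
  let a21 := Derive (fun x => T01 p x v) rho in
  let a22 := Derive (fun y => T01 p rho y) v in
  let d := a11 * a22 - a12 * a21 in
  ((a22 * fst U' - a12 * snd U') / d, (a11 * snd U' - a21 * fst U') / d).

(** D_- psi_- / Dt at (0, r0) computed from the data (rho, v), U' by means of
    V_t = H - J V_r, with d psi_- = c_s/(rho+p) d rho + 1/(1-v^2) d v. *)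
Definition Dminus_psi_minus_data (p : R -> R) (kappa A B r rho v : R) (U' : R * R) : R :=
  let rho_r := fst (primitive_slope p rho v U') in
  let v_r := snd (primitive_slope p rho v U') in
  let rho_t := H1 p kappa A B r rho v
               - (Jdiag p A B rho v * rho_r + J12 p A B rho v * v_r) in
  let v_t := H2 p kappa A B r rho v
             - (J21 p A B rho v * rho_r + Jdiag p A B rho v * v_r) in
  cs p rho / (rho + p rho) * (rho_t + lam_minus p A B rho v * rho_r)
  + 1 / (1 - v ^ 2) * (v_t + lam_minus p A B rho v * v_r).

Definition coef_a (p : R -> R) (rho : R) : R := cs p rho / (rho + p rho).
Definition coef_b (v : R) : R := 1 / (1 - v ^ 2).

(** [DL] stands for (D_- psi_- / Dt)_L; A, B, r are the values at (0, r0). *)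
Definition coef_d (p : R -> R) (kappa A B r : R) (DL rhoL vL rhoS vS : R)
    (wrho wv : R -> R) : R :=
  let bL := lam_minus p A B rhoL vL in
  let bS := lam_minus p A B rhoS vS in
  let lp := lam_plus p A B rhoS vS in
  let lm := lam_minus p A B rhoS vS in
  let gap := fun b => lam_plus p A B (wrho b) (wv b) - lam_minus p A B (wrho b) (wv b) in
  lp / (lp - lm) * DL * exp (- RInt (fun b => 1 / gap b) bL bS)
  - lm * s_minus p kappa A B r rhoS vS / (lp - lm)
  + lp / (lp - lm)
    * RInt (fun b => s_minus p kappa A B r (wrho b) (wv b) / gap b
                     * exp (- RInt (fun w => 1 / gap w) b bS)) bL bS.

(* Main.v *)
Require Import Defs.
From Stdlib Require Import Reals Lra Psatz.
From Coquelicot Require Import Coquelicot.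
Open Scope R_scope.

(** Write [a = c_s / (rho + p)] and [b = 1 / (1 - v^2)], so that
    [d psi_- = a d rho + b d v], and let [X = a rho_t + b v_t],
    [Y = a rho_r + b v_r] in a smooth region.  The covector [(a, b)] is a left
    eigenvector of [J] for [lambda_+], so the balance laws yield the scalar relation
    [X + lambda_+ Y = s_-] ([characteristic_form]).  Behind the fan (subscript [S]) this
    is one linear equation for the two unknowns [X_S] and [Y_S]; a second one is the value
    [D_S = X_S + lambda_- Y_S] of the derivative of [psi_-] along the trailing edge of
    the fan.  Eliminating [Y_S] gives
    [X_S = (lambda_+ D_S - lambda_- s_-) / (lambda_+ - lambda_-)], and [X_S] is the
    left-hand side of the assertion.  So all that matters is how [D_S] is obtained from
    the corresponding rate [D_L] ahead of the fan.

    Characteristic coordinates resolve the singular point into the segment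
    [alpha = 0].  There [t_beta = 0], and the two characteristic equations
    [r_alpha = lambda_- t_alpha] and [r_beta = lambda_+ t_beta], differentiated once
    more and compared through the mixed derivative of [r], give
    [(lambda_+ - lambda_-) t_alpha_beta = t_alpha], because [lambda_- (0, beta) = beta]
    ([origin_mixed_time]).  In the same way [psi_beta = s_- t_beta] gives
    [psi_alpha_beta = s_- t_alpha_beta] at [alpha = 0] ([origin_psi_a_derivative]).
    Both are linear equations in [beta] for [t_alpha] and [psi_alpha], and
    [psi_alpha / t_alpha] is the derivative of [psi_-] along the [lambda_-]-curves.
    Since [t_alpha (0, beta) / t_alpha (0, beta_S)] is exactly the exponential in the
    formula, integrating across the fan yields [D_S] in terms of [D_L]
    ([fan_integral]).

    Two matching arguments connect the fan with its neighbours.  The state is only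
    continuous across the bounding characteristics, and derivatives are controlled only
    inside the open regions; so an edge is approached by curves in the interior of the
    adjacent region, along which the mean value theorem applies with estimates that are
    uniform up to the edge ([edge_increment], [edge_chart_derivative]).  Finally, the
    slopes of the left state at the singular point are those of the initial data, again
    by a mean value argument, now on segments at times tending to zero
    ([initial_slope], [left_slopes]). *)

(** The records of hypotheses have all their data as explicit parameters; these
    abbreviations leave them to be inferred from the hypothesis. *)
Local Notation of_riemann f H := (f _ _ _ _ _ _ _ _ _ _ _ _ H) (only parsing).
Local Notation of_grp f H := (f _ _ _ _ _ _ _ _ _ _ _ _ _ _ _ _ _ _ _ _ _ _ H) (only parsing).
Local Notation of_grp_eos f Hp H := (f _ _ _ _ _ _ _ _ _ _ _ _ _ _ _ _ _ _ _ _ _ _ Hp H) (only parsing).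
Local Notation of_fan f H := (f _ _ _ _ _ _ _ _ _ _ _ _ H) (only parsing).

(** * Limits and one-sided derivatives *)

Section Limits.
Context {X : Type} (F : (X -> Prop) -> Prop) {FF : Filter F}.

Lemma lim_plus (f g : X -> R) a b :
  filterlim f F (locally a) -> filterlim g F (locally b) ->
  filterlim (fun x => f x + g x) F (locally (a + b)).
Proof. intros Hf Hg. exact (filterlim_comp_2 _ _ Rplus Hf Hg (filterlim_plus a b)). Qed.

Lemma lim_mult (f g : X -> R) a b :
  filterlim f F (locally a) -> filterlim g F (locally b) ->
  filterlim (fun x => f x * g x) F (locally (a * b)).
Proof. intros Hf Hg. exact (filterlim_comp_2 _ _ Rmult Hf Hg (filterlim_mult a b)). Qed.

Lemma lim_opp (f : X -> R) a :
  filterlim f F (locally a) -> filterlim (fun x => - f x) F (locally (- a)).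
Proof. intros Hf. exact (filterlim_comp _ _ _ _ Ropp _ _ _ Hf (filterlim_opp a)). Qed.

Lemma lim_minus (f g : X -> R) a b :
  filterlim f F (locally a) -> filterlim g F (locally b) ->
  filterlim (fun x => f x - g x) F (locally (a - b)).
Proof. intros Hf Hg. apply lim_plus; [|apply lim_opp]; assumption. Qed.

Lemma lim_comp (h : R -> R) (f : X -> R) a :
  continuous h a -> filterlim f F (locally a) ->
  filterlim (fun x => h (f x)) F (locally (h a)).
Proof. intros Hh Hf. exact (filterlim_comp _ _ _ f h _ _ _ Hf Hh). Qed.

Lemma lim_sqrt (f : X -> R) a :
  filterlim f F (locally a) -> filterlim (fun x => sqrt (f x)) F (locally (sqrt a)).
Proof. apply lim_comp, continuous_sqrt. Qed.

Lemma lim_div (f g : X -> R) a b : b <> 0 ->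
  filterlim f F (locally a) -> filterlim g F (locally b) ->
  filterlim (fun x => f x / g x) F (locally (a / b)).
Proof.
  intros Hb Hf Hg. apply lim_mult; [assumption|].
  apply (lim_comp Rinv); [|assumption].
  apply (ex_derive_continuous Rinv), ex_derive_Reals_1. apply derivable_pt_inv; [assumption|].
  apply derivable_pt_id.
Qed.

Lemma lim_pow (f : X -> R) a n :
  filterlim f F (locally a) -> filterlim (fun x => f x ^ n) F (locally (a ^ n)).
Proof.
  intros Hf. induction n as [|n IH]; simpl; [apply filterlim_const|now apply lim_mult].
Qed.

Lemma lim_within (D : X -> Prop) (f : X -> R) a :
  filterlim f F (locally a) -> filterlim f (within D F) (locally a).
Proof.
  intros Hf P HP. unfold filtermap, within.
  apply (filter_imp (fun x => P (f x))); [intros x Hx _; exact Hx|exact (Hf P HP)].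
Qed.

End Limits.

(** A derivative is a limit of difference quotients from either side alone; hence
    two functions that agree on an interval have equal derivatives even at its ends. *)
Lemma is_derive_eq_on_segment (f g : R -> R) (l u x a b : R) :
  l < u -> l <= x <= u -> (forall y, l <= y <= u -> f y = g y) ->
  is_derive f x a -> is_derive g x b -> a = b.
Proof.
  intros Hlu Hx Hfg Ha Hb.
  assert (Hd : is_derive (fun y => f y - g y) x (a - b)) by exact (is_derive_minus _ _ _ _ _ Ha Hb).
  apply is_derive_Reals in Hd.
  apply cond_eq. intros e He. destruct (Hd e He) as [d Hd'].
  set (m := Rmin (d / 2) ((u - l) / 2)).
  assert (Hm : 0 < m) by (apply Rmin_glb_lt; [destruct d; simpl; lra|lra]).
  assert (Hm1 : m < d) by (unfold m; destruct d as [d D0]; simpl; pose proof (Rmin_l (d/2) ((u-l)/2)); lra).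
  assert (Hm2 : m <= (u - l) / 2) by apply Rmin_r.
  assert (Hh : exists h, h <> 0 /\ Rabs h = m /\ l <= x + h <= u).
  { destruct (Rle_dec x ((l + u) / 2)).
    - exists m. rewrite Rabs_pos_eq; lra.
    - exists (- m). rewrite Rabs_Ropp, Rabs_pos_eq; lra. }
  destruct Hh as (h & Hh0 & Hhm & Hxh).
  specialize (Hd' h Hh0 ltac:(lra)). rewrite (Hfg x), (Hfg (x + h)) in Hd' by lra.
  replace ((_ - _) / h - (a - b)) with (- (a - b)) in Hd' by (field; assumption).
  now rewrite Rabs_Ropp in Hd'.
Qed.

(** Equations derived in the open fan extend to its edges by continuity. *)
Lemma eq_on_closed_segment (f g : R -> R) l u x :
  l < u -> l <= x <= u -> (forall y, l < y < u -> f y = g y) ->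
  continuous f x -> continuous g x -> f x = g x.
Proof.
  intros Hlu Hx Hfg Cf Cg.
  assert (Hd : filterlim (fun y => f y - g y) (locally x) (locally (f x - g x)))
    by (apply lim_minus; [apply locally_filter|exact Cf|exact Cg]).
  apply cond_eq. intros e He.
  destruct (proj1 (filterlim_locally _ _) Hd (mkposreal e He)) as [d Hd'].
  set (m := Rmin (d / 2) ((u - l) / 3)).
  assert (Hm : 0 < m) by (apply Rmin_glb_lt; [destruct d; simpl; lra|lra]).
  assert (Hm1 : m < d) by (unfold m; destruct d as [d D0]; simpl; pose proof (Rmin_l (d/2) ((u-l)/3)); lra).
  assert (Hm2 : m <= (u - l) / 3) by apply Rmin_r.
  assert (Hh : exists h, Rabs h = m /\ l < x + h < u).
  { destruct (Rle_dec x ((l + u) / 2)).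
    - exists m. rewrite Rabs_pos_eq; lra.
    - exists (- m). rewrite Rabs_Ropp, Rabs_pos_eq; lra. }
  destruct Hh as (h & Hhm & Hxh).
  specialize (Hd' (x + h)). change (ball x d (x + h)) with (Rabs (x + h - x) < d) in Hd'.
  replace (x + h - x) with h in Hd' by ring. specialize (Hd' ltac:(lra)).
  change (Rabs ((f (x + h) - g (x + h)) - (f x - g x)) < e) in Hd'.
  rewrite (Hfg (x + h)) in Hd' by lra.
  replace (_ - _ - _) with (- (f x - g x)) in Hd' by ring.
  now rewrite Rabs_Ropp in Hd'.
Qed.

Lemma left_quotient (h : R -> R) (x h' : R) : is_derive h x h' ->
  filterlim (fun y => (h y - h x) / (y - x)) (at_left x) (locally h').
Proof.
  intros Hh. apply is_derive_Reals in Hh.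
  apply filterlim_locally. intros e. destruct (Hh e (cond_pos e)) as [d Hd].
  exists d. intros y Hy Hyx. change (Rabs (y - x) < d) in Hy.
  specialize (Hd (y - x) ltac:(lra) Hy). rewrite Rplus_minus in Hd. exact Hd.
Qed.

(** Both sides are divided by the distance to the common zero of [f] and [g]; the factor
    [k], later a characteristic speed or the source term, then enters through its limit. *)
Lemma left_derivative_of_product (f g k : R -> R) (x0 x k0 f' g' : R) :
  x0 < x -> (forall y, x0 < y < x -> f y = k y * g y) -> g x = 0 ->
  filterlim k (at_left x) (locally k0) ->
  is_derive f x f' -> is_derive g x g' -> f' = k0 * g'.
Proof.
  intros Hx Hfg Hg0 Hk Hf Hg.
  assert (FL : Filter (at_left x)) by apply within_filter, locally_filter.
  assert (L : forall (h : R -> R) (h' : R), is_derive h x h' -> filterlim h (at_left x) (locally (h x))).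
  { intros h h' Hh. apply lim_within; [apply locally_filter|].
    apply (ex_derive_continuous h). now exists h'. }
  assert (Near : at_left x (fun y => x0 < y < x)).
  { assert (Hx' : 0 < x - x0) by lra. exists (mkposreal _ Hx'). intros y Hy Hyx.
    change (Rabs (y - x) < x - x0) in Hy. apply Rabs_def2 in Hy. lra. }
  assert (Hf0 : f x = 0).
  { apply (filterlim_locally_unique (F := at_left x) f).
    - now apply (L f f').
    - rewrite <- (Rmult_0_r k0), <- Hg0.
      apply (filterlim_ext_loc (fun y => k y * g y)).
      + revert Near. apply filter_imp. intros y Hy. symmetry. now apply Hfg.
      + apply lim_mult; [assumption|assumption|now apply (L g g')]. }
  assert (Q : forall (h : R -> R) (h' : R), is_derive h x h' -> h x = 0 ->
    filterlim (fun y => h y / (y - x)) (at_left x) (locally h')).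
  { intros h h' Hh Hh0. apply left_quotient in Hh. revert Hh. rewrite Hh0.
    apply filterlim_ext. intros y. now rewrite Rminus_0_r. }
  apply (filterlim_locally_unique (F := at_left x) (fun y => f y / (y - x))).
  - now apply Q.
  - apply (filterlim_ext_loc (fun y => k y * (g y / (y - x)))).
    + revert Near. apply filter_imp. intros y Hy. rewrite Hfg by lra. field. lra.
    + apply lim_mult; [assumption|assumption|now apply Q].
Qed.

(** * The fluid variables *)

Section Fluid.
Variable p : R -> R.
Hypothesis Hp : eos p.

Lemma W_sqr v : -1 < v < 1 -> W v ^ 2 = / (1 - v ^ 2).
Proof.
  intros Hv. assert (0 < 1 - v ^ 2) by nra. unfold W.
  assert (H0 := sqrt_lt_R0 _ H). rewrite <- (sqrt_sqrt (1 - v ^ 2)) at 2 by lra.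
  field. lra.
Qed.

Lemma T00_eq rho v : -1 < v < 1 -> T00 p rho v = (rho + p rho) / (1 - v ^ 2) - p rho.
Proof. intros Hv. unfold T00. rewrite W_sqr by assumption. unfold Rdiv. ring. Qed.

Lemma T01_eq rho v : -1 < v < 1 -> T01 p rho v = (rho + p rho) * v / (1 - v ^ 2).
Proof. intros Hv. unfold T01. rewrite W_sqr by assumption. unfold Rdiv. ring. Qed.

Lemma T11_eq rho v : -1 < v < 1 -> T11 p rho v = (rho * v ^ 2 + p rho) / (1 - v ^ 2).
Proof. intros Hv. unfold T11. rewrite W_sqr by assumption. unfold Rdiv. ring. Qed.

Lemma cs_bounds rho : 0 < rho -> 0 < cs p rho < 1 /\ cs p rho ^ 2 = Derive p rho.
Proof.
  intros H. destruct (Hp rho H) as (_ & _ & Hd & _). unfold cs. split; [split|].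
  - apply sqrt_lt_R0. lra.
  - rewrite <- sqrt_1. apply sqrt_lt_1; lra.
  - simpl. rewrite Rmult_1_r. apply sqrt_sqrt. lra.
Qed.

Lemma physical_bounds rho v : physical rho v ->
  0 < rho + p rho /\ 0 < 1 - v ^ 2 /\ 0 < 1 - v * cs p rho /\ 0 < 1 + v * cs p rho /\
  0 < 1 - v ^ 2 * cs p rho ^ 2.
Proof.
  intros [Hr Hv]. destruct (cs_bounds rho Hr) as [Hc _].
  destruct (Hp rho Hr) as (Hpp & _).
  assert (0 < 1 - v * cs p rho) by nra. assert (0 < 1 + v * cs p rho) by nra.
  repeat split; try lra; try nra.
Qed.

Lemma lam_gap_pos A B rho v : 0 < A -> 0 < B -> physical rho v ->
  0 < lam_plus p A B rho v - lam_minus p A B rho v.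
Proof.
  intros HA HB Hph. destruct (physical_bounds _ _ Hph) as (_ & Hn & H1 & H2 & H3).
  destruct (cs_bounds rho (proj1 Hph)) as [Hc _].
  unfold lam_plus, lam_minus.
  assert (0 < sqrt (A * B)) by (apply sqrt_lt_R0; nra).
  replace (_ - _) with (sqrt (A * B) * (2 * cs p rho * (1 - v ^ 2)
    / ((1 + v * cs p rho) * (1 - v * cs p rho)))) by (field; lra).
  apply Rmult_lt_0_compat; [assumption|]. apply Rdiv_lt_0_compat; nra.
Qed.

(** ** Continuity of the coefficients *)

Definition T00_rho (rho v : R) : R := (1 + Derive p rho) / (1 - v ^ 2) - Derive p rho.
Definition T00_v (rho v : R) : R := (rho + p rho) * (2 * v) / (1 - v ^ 2) ^ 2.
Definition T01_rho (rho v : R) : R := (1 + Derive p rho) * v / (1 - v ^ 2).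
Definition T01_v (rho v : R) : R := (rho + p rho) * (1 + v ^ 2) / (1 - v ^ 2) ^ 2.
Definition T11_rho (rho v : R) : R := (v ^ 2 + Derive p rho) / (1 - v ^ 2).

Section Limits.
Context {X : Type} (F : (X -> Prop) -> Prop) {FF : Filter F}.
Variables (rho v : X -> R) (rho0 v0 : R).
Hypotheses (Hrho : filterlim rho F (locally rho0)) (Hv : filterlim v F (locally v0)).
Hypothesis Hph : physical rho0 v0.

Lemma lim_p : filterlim (fun x => p (rho x)) F (locally (p rho0)).
Proof.
  apply (lim_comp F p); [|assumption]. apply (ex_derive_continuous p). now apply Hp, Hph.
Qed.

Lemma lim_Dp : filterlim (fun x => Derive p (rho x)) F (locally (Derive p rho0)).
Proof.
  apply (lim_comp F (Derive p)); [|assumption]. apply (ex_derive_continuous (Derive p)). now apply Hp, Hph.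
Qed.

Lemma lim_cs : filterlim (fun x => cs p (rho x)) F (locally (cs p rho0)).
Proof. apply lim_sqrt, lim_Dp. Qed.

Lemma lim_coef_a : filterlim (fun x => coef_a p (rho x)) F (locally (coef_a p rho0)).
Proof.
  destruct (physical_bounds _ _ Hph) as (HE & _).
  apply lim_div; [assumption|lra|apply lim_cs|apply lim_plus; [assumption|assumption|apply lim_p]].
Qed.

Lemma lim_one_minus_sqr : filterlim (fun x => 1 - v x ^ 2) F (locally (1 - v0 ^ 2)).
Proof. apply lim_minus; [assumption|apply filterlim_const|now apply lim_pow]. Qed.

Lemma lim_coef_b : filterlim (fun x => coef_b (v x)) F (locally (coef_b v0)).
Proof.
  destruct (physical_bounds _ _ Hph) as (_ & Hn & _).
  apply lim_div; [assumption|lra|apply filterlim_const|apply lim_one_minus_sqr].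
Qed.

Variables (A B : X -> R) (A0 B0 : R).
Hypotheses (HA : filterlim A F (locally A0)) (HB : filterlim B F (locally B0)).

(* Matching on the syntax of the function keeps unification from unfolding the speeds. *)
Ltac lims :=
  lazymatch goal with
  | |- filterlim (fun x => @?f x + @?g x) _ _ => apply (lim_plus F f g); lims
  | |- filterlim (fun x => @?f x - @?g x) _ _ => apply (lim_minus F f g); lims
  | |- filterlim (fun x => @?f x * @?g x) _ _ => apply (lim_mult F f g); lims
  | |- filterlim (fun x => @?f x / @?g x) _ _ => apply (lim_div F f g); lims
  | |- filterlim (fun x => - @?f x) _ _ => apply (lim_opp F f); lims
  | |- filterlim (fun x => @?f x ^ _) _ _ => apply (lim_pow F f); lims
  | |- filterlim (fun x => sqrt (@?f x)) _ _ => apply (lim_sqrt F f); lims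
  | |- filterlim (fun x => cs p _) _ _ => apply lim_cs
  | |- filterlim (fun x => Derive p _) _ _ => apply lim_Dp
  | |- filterlim (fun x => p _) _ _ => apply lim_p
  | |- filterlim _ _ _ => first [assumption | apply filterlim_const]
  | |- _ => idtac
  end.

Lemma lim_lam_plus :
  filterlim (fun x => lam_plus p (A x) (B x) (rho x) (v x)) F (locally (lam_plus p A0 B0 rho0 v0)).
Proof.
  destruct (physical_bounds _ _ Hph) as (HE & Hn & Hm & Hq & Hd). unfold lam_plus. lims. lra.
Qed.

Lemma lim_lam_minus :
  filterlim (fun x => lam_minus p (A x) (B x) (rho x) (v x)) F (locally (lam_minus p A0 B0 rho0 v0)).
Proof.
  destruct (physical_bounds _ _ Hph) as (HE & Hn & Hm & Hq & Hd). unfold lam_minus. lims. lra.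
Qed.

Lemma lim_s_minus (kappa : R) (r : X -> R) (r0 : R) : 0 < A0 -> 0 < r0 ->
  filterlim r F (locally r0) ->
  filterlim (fun x => s_minus p kappa (A x) (B x) (r x) (rho x) (v x)) F
    (locally (s_minus p kappa A0 B0 r0 rho0 v0)).
Proof.
  destruct (physical_bounds _ _ Hph) as (HE & Hn & Hm & Hq & Hd). intros HA0 Hr0 Hr.
  unfold s_minus, H1, H2.
  lims; try lra; apply Rmult_integral_contrapositive_currified; lra.
Qed.

Lemma lim_W_sqr : filterlim (fun x => W (v x) ^ 2) F (locally (W v0 ^ 2)).
Proof.
  destruct (physical_bounds _ _ Hph) as (_ & Hn & _). unfold W. lims.
  apply Rgt_not_eq, sqrt_lt_R0, Hn.
Qed.

Lemma lim_T00 : filterlim (fun x => T00 p (rho x) (v x)) F (locally (T00 p rho0 v0)).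
Proof.
  pose proof lim_W_sqr. unfold T00. apply lim_minus; [assumption| |apply lim_p].
  apply lim_mult; [assumption| |assumption]. lims.
Qed.

Lemma lim_T01 : filterlim (fun x => T01 p (rho x) (v x)) F (locally (T01 p rho0 v0)).
Proof.
  pose proof lim_W_sqr. unfold T01. apply lim_mult; [assumption| |assumption].
  apply lim_mult; [assumption| |assumption]. lims.
Qed.

Lemma lim_T00_rho : filterlim (fun x => T00_rho (rho x) (v x)) F (locally (T00_rho rho0 v0)).
Proof.
  destruct (physical_bounds _ _ Hph) as (HE & Hn & _). unfold T00_rho. lims. lra.
Qed.

Lemma lim_T01_rho : filterlim (fun x => T01_rho (rho x) (v x)) F (locally (T01_rho rho0 v0)).
Proof.
  destruct (physical_bounds _ _ Hph) as (HE & Hn & _). unfold T01_rho. lims. lra.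
Qed.

Lemma lim_T00_v : filterlim (fun x => T00_v (rho x) (v x)) F (locally (T00_v rho0 v0)).
Proof.
  destruct (physical_bounds _ _ Hph) as (HE & Hn & _). unfold T00_v. lims. now apply pow_nonzero, Rgt_not_eq.
Qed.

Lemma lim_T01_v : filterlim (fun x => T01_v (rho x) (v x)) F (locally (T01_v rho0 v0)).
Proof.
  destruct (physical_bounds _ _ Hph) as (HE & Hn & _). unfold T01_v. lims. now apply pow_nonzero, Rgt_not_eq.
Qed.

End Limits.

Lemma ex_derive_coef_a (r : R) : 0 < r -> ex_derive (coef_a p) r.
Proof.
  intros Hr. destruct (Hp r Hr) as (Hpp & Ep & Hd & Ed & _). unfold coef_a, cs.
  auto_derive. repeat split; try assumption; lra.
Qed.

Lemma ex_derive_coef_b v : -1 < v < 1 -> ex_derive coef_b v.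
Proof. intros Hv. unfold coef_b. auto_derive. nra. Qed.

(** ** Derivatives along a curve of states *)

Section Curve.
Variables (rho v : R -> R) (x rho' v' : R).
Hypothesis Hph : physical (rho x) (v x).
Hypotheses (Hrho : is_derive rho x rho') (Hv : is_derive v x v').

Lemma subluminal_nearby : locally x (fun s => -1 < v s < 1).
Proof.
  assert (Cv : continuous v x) by (apply (ex_derive_continuous v); now exists v').
  apply (Cv (fun w => -1 < w < 1)).
  apply (open_and (fun w => -1 < w) (fun w => w < 1)); [apply open_gt|apply open_lt|apply Hph].
Qed.

Ltac differentiate f :=
  destruct (physical_bounds _ _ Hph) as (HE & Hn & _);
  destruct (Hp _ (proj1 Hph)) as (_ & Ep & _);
  apply (is_derive_ext_loc f);
  [ generalize subluminal_nearby; apply filter_imp; intros s Hs;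
    match goal with |- ?a = ?b => change (@eq R a b) end;
    unfold T00, T01, T11; rewrite (W_sqr _ Hs); unfold Rdiv; ring
  | auto_derive;
    [ repeat split; try (eexists; eassumption); try exact Ep; lra
    | replace (Derive (fun y : R => rho y) x) with rho' by (symmetry; exact (is_derive_unique _ _ _ Hrho));
      replace (Derive (fun y : R => v y) x) with v' by (symmetry; exact (is_derive_unique _ _ _ Hv));
      change (fun y : R => p y) with p;
      unfold T00_rho, T00_v, T01_rho, T01_v, T11_rho; field; lra ] ].

Lemma is_derive_T00 : is_derive (fun s => T00 p (rho s) (v s)) x
  (T00_rho (rho x) (v x) * rho' + T00_v (rho x) (v x) * v').
Proof. differentiate (fun s => (rho s + p (rho s)) / (1 - v s ^ 2) - p (rho s)). Qed.

Lemma is_derive_T01 : is_derive (fun s => T01 p (rho s) (v s)) x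
  (T01_rho (rho x) (v x) * rho' + T01_v (rho x) (v x) * v').
Proof. differentiate (fun s => (rho s + p (rho s)) / (1 - v s ^ 2) * v s). Qed.

Lemma is_derive_T11 : is_derive (fun s => T11 p (rho s) (v s)) x
  (T11_rho (rho x) (v x) * rho' + T00_v (rho x) (v x) * v').
Proof. differentiate (fun s => (rho s * v s ^ 2 + p (rho s)) / (1 - v s ^ 2)). Qed.

Lemma is_derive_psi_minus rho_ref : 0 < rho_ref ->
  is_derive (fun s => psi_minus p rho_ref (rho s) (v s)) x
    (coef_a p (rho x) * rho' + coef_b (v x) * v').
Proof.
  intros Href. destruct (physical_bounds _ _ Hph) as (HE & Hn & _). destruct Hph as [Hr Hvx].
  assert (Ca : forall w, 0 < w -> continuous (coef_a p) w)
    by (intros w Hw; apply (ex_derive_continuous (coef_a p)), ex_derive_coef_a, Hw).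
  assert (DI : is_derive (RInt (coef_a p) rho_ref) (rho x) (coef_a p (rho x))).
  { apply (is_derive_RInt _ _ rho_ref); [|now apply Ca].
    assert (Hpos : locally (rho x) (fun w => 0 < w)) by (apply open_gt, Hr).
    revert Hpos. apply filter_imp. intros w Hw. apply (RInt_correct (coef_a p)).
    apply (ex_RInt_continuous (coef_a p)). intros z Hz. apply Ca.
    apply Rlt_le_trans with (2 := proj1 Hz). now apply Rmin_glb_lt. }
  unfold psi_minus. rewrite Rplus_comm.
  apply (is_derive_plus (fun s => 1 / 2 * ln ((1 + v s) / (1 - v s)))
    (fun s => RInt (coef_a p) rho_ref (rho s))).
  - assert (Hlog : 0 < (1 + v x) / (1 - v x)) by (apply Rdiv_lt_0_compat; lra).
    auto_derive.
    + repeat split; [now exists v'|now exists v'|lra|exact Hlog].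
    + replace (Derive (fun y : R => v y) x) with v' by (symmetry; exact (is_derive_unique _ _ _ Hv)).
      unfold coef_b. field. repeat split; nra.
  - rewrite Rmult_comm. exact (is_derive_comp (RInt (coef_a p) rho_ref) rho x _ _ DI Hrho).
Qed.

End Curve.
End Fluid.

(** * Fields on the plane *)

(** Existence of the partial derivatives near the point and continuity of one of them
    give total differentiability, which the chain rule needs. *)
Lemma C1_at_filterdiff f (q : R * R) : locally q (C1_at f) ->
  filterdiff (uncurry f) (locally q)
    (fun u => plus (scal (fst u) (D1 f (fst q) (snd q))) (scal (snd u) (D2 f (fst q) (snd q)))).
Proof.
  intros Hf. destruct q as [x y]. simpl.
  destruct (locally_singleton _ _ Hf) as (_ & E2 & C1 & _). simpl in E2.
  apply (is_derive_filterdiff f x y (D1 f) (D2 f x y)).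
  - revert Hf. apply filter_imp. intros u (E1 & _). now apply Derive_correct.
  - now apply Derive_correct.
  - exact C1.
Qed.

Lemma C1_at_continuous f (q : R * R) : locally q (C1_at f) -> continuous (uncurry f) q.
Proof.
  intros Hf.
  refine (@filterdiff_continuous R_AbsRing
    (prod_NormedModule R_AbsRing R_NormedModule R_NormedModule) R_NormedModule (uncurry f) q _).
  eexists. exact (C1_at_filterdiff f q Hf).
Qed.

Lemma is_derive_along f (x y : R -> R) (s x' y' : R) :
  locally (x s, y s) (C1_at f) -> is_derive x s x' -> is_derive y s y' ->
  is_derive (fun s => f (x s) (y s)) s (D1 f (x s) (y s) * x' + D2 f (x s) (y s) * y').
Proof.
  intros Hf Hx Hy. apply C1_at_filterdiff in Hf. simpl in Hf.
  refine (filterdiff_ext_lin _ _ _ (filterdiff_comp'_2 x y f s _ _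
    (fun a b => plus (scal a (D1 f (x s) (y s))) (scal b (D2 f (x s) (y s)))) Hx Hy Hf) _).
  intros h. unfold scal; simpl. unfold plus, mult; simpl. unfold mult; simpl. ring.
Qed.

Lemma locally_between (T : R) (c1 c2 : R -> R) (t r : R) : continuous c1 t -> continuous c2 t ->
  between T c1 c2 (t, r) -> locally (t, r) (between T c1 c2).
Proof.
  intros K1 K2 [Ht Hr]. simpl in Ht, Hr.
  set (gap := fun (c : R -> R) (q : R * R) => snd q - c (fst q)).
  assert (Cgap : forall c, continuous c t -> continuous (gap c) (t, r)).
  { intros c Kc. apply (continuous_minus (fun q : R * R => snd q) (fun q => c (fst q))).
    - apply continuous_snd.
    - apply (continuous_comp fst c); [apply continuous_fst|exact Kc]. }
  assert (L1 : locally (t, r) (fun q : R * R => 0 < fst q)).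
  { apply (continuous_fst t r (fun z : R => 0 < z)), open_gt, Ht. }
  assert (L2 : locally (t, r) (fun q : R * R => fst q < T)).
  { apply (continuous_fst t r (fun z : R => z < T)), open_lt, Ht. }
  assert (L3 : locally (t, r) (fun q : R * R => 0 < gap c1 q)).
  { apply (Cgap c1 K1 (fun z => 0 < z)), open_gt. unfold gap. simpl. lra. }
  assert (L4 : locally (t, r) (fun q : R * R => gap c2 q < 0)).
  { apply (Cgap c2 K2 (fun z => z < 0)), open_lt. unfold gap. simpl. lra. }
  generalize (filter_and _ _ (filter_and _ _ L1 L2) (filter_and _ _ L3 L4)).
  apply filter_imp. unfold gap. intros q. unfold between. lra.
Qed.

Lemma tends_along (Om : R * R -> Prop) f (r0 l tau : R) (gam : R -> R) :
  0 < tau -> (forall t, 0 < t < tau -> Om (t, gam t)) ->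
  filterlim gam (at_right 0) (locally r0) ->
  tends Om f (0, r0) l -> filterlim (fun t => f t (gam t)) (at_right 0) (locally l).
Proof.
  intros Htau Hin Hg Hf.
  apply (filterlim_comp _ _ _ (fun t => (t, gam t)) (uncurry f) _ (within Om (locally (0, r0)))); [|exact Hf].
  intros P [e He].
  assert (N1 : at_right 0 (fun t => 0 < t < tau)).
  { exists (mkposreal tau Htau). intros t Ht Ht0. change (Rabs (t - 0) < tau) in Ht.
    rewrite Rminus_0_r in Ht. apply Rabs_def2 in Ht. lra. }
  assert (N2 : at_right 0 (fun t => ball 0 e t)).
  { exists e. intros t Ht _. exact Ht. }
  assert (N3 := proj1 (filterlim_locally _ _) Hg e).
  generalize (filter_and _ _ N1 (filter_and _ _ N2 N3)). unfold filtermap.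
  apply filter_imp. intros t (Ht & B1 & B2). apply He; [now split|now apply Hin].
Qed.

(** * The characteristic form of the balance laws *)

(** Here [n = 1 - v^2], [E = rho + p] and [C = sqrt (A B)]; [C'] is the value of
    [C_r] dictated by the constraints on the metric.  The combination of the two balance
    laws is the one that turns [dU] into [d psi_-]. *)
Lemma characteristic_combination (C c kappa A r rho pr v rt rr vt vr : R) :
  A <> 0 -> r <> 0 -> rho + pr <> 0 -> 1 - v ^ 2 <> 0 -> 1 + v * c <> 0 -> 1 - v * c <> 0 ->
  let n := 1 - v^2 in let E := rho + pr in 
  let t00 := E / n - pr in let t01 := E * v / n in let t11 := (rho * v^2 + pr) / n in
  let C' := C * ((1 - A) / (A * r) + kappa * r / (2 * A) * (t11 - t00)) in
  ((1 + c^2) / n - c^2) * rt + E * (2 * v) / n^2 * vt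
   + (C' * t01 + C * ((1 + c^2) * v / n * rr + E * (1 + v^2) / n^2 * vr))
   = - C * (2 / r * t01) ->
  (1 + c^2) * v / n * rt + E * (1 + v^2) / n^2 * vt
   + (C' * t11 + C * ((v^2 + c^2) / n * rr + E * (2 * v) / n^2 * vr))
   = - C * (2 / r * t11 + (1 - A) / (2 * A * r) * (t00 - t11)
      + kappa * r / A * (t00 * t11 - t01 ^ 2) - 2 * pr / r) ->
  (c / E * rt + 1 / n * vt) + C * ((v + c) / (1 + v * c)) * (c / E * rr + 1 / n * vr)
  = 1 / n * (- (C * n / (r * (1 - v ^ 2 * c ^ 2))) * (- 2 * v ^ 2 * c ^ 2
     + (1 - A) * (1 - v ^ 2 * c ^ 2) / (2 * A)
     + kappa * r ^ 2 * (pr + rho * v ^ 2 * c ^ 2) / (2 * A)))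
   + c / E * (- (C / (r * (1 - v ^ 2 * c ^ 2))) * (2 * v * (rho + pr))
  * (1 - kappa * r ^ 2 * (rho + pr) / (4 * A))).
Proof.
  intros HA Hr HE Hn H1 H2 n E t00 t01 t11 C' En Mo.
  assert (H3 : 1 - v^2*c^2 <> 0).
  { replace (1 - v^2*c^2) with ((1+v*c)*(1-v*c)) by ring. now apply Rmult_integral_contrapositive_currified. }
  apply Rminus_diag_uniq.
  match type of En with ?l = ?r => set (e := l - r) end.
  match type of Mo with ?l = ?r => set (m := l - r) end.
  assert (He : e = 0) by (unfold e; lra). assert (Hm : m = 0) by (unfold m; lra).
  (* [D] is the determinant of [dU / d(rho, v)]; the two multipliers below are the
     solution of the linear system that expresses [d psi_-] through [dU]. *)
  set (D := E * (1 - v^2*c^2) / n^2).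
  transitivity ((c / E * (E * (1 + v^2) / n^2) - 1 / n * ((1+c^2)*v/n)) / D * e
    + (1 / n * ((1+c^2)/n - c^2) - c / E * (E * (2 * v)/ n^2)) / D * m); [|rewrite He, Hm; ring].
  clear En Mo He Hm. unfold e, m, D, C', t00, t01, t11, E, n in *. clear - HA Hr HE Hn H1 H2 H3.
  field. repeat split; auto. nra.
Qed.

Section Characteristic.
Variables (p : R -> R) (kappa : R) (Q : flow) (Om : R * R -> Prop).
Hypotheses (Hp : eos p) (HQ : classical_solution p kappa Q Om).
Variables t r : R.
Hypotheses (Hr : 0 < r) (HOm : locally (t, r) Om).
Hypothesis Hph : physical (f_rho Q t r) (f_v Q t r).
Hypotheses (HA : 0 < f_A Q t r) (HB : 0 < f_B Q t r).
Hypothesis HM : locally r (fun x => f_A Q t x = 1 - 2 * f_M Q t x / x).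

(** Logarithmic differentiation of [A B], with [A_r] from [A = 1 - 2 M / r] and the mass
    equation, and [B_r] from the second constraint. *)
Lemma is_derive_fsqrtAB : is_derive (fun x => fsqrtAB Q t x) r
  (fsqrtAB Q t r * ((1 - f_A Q t r) / (f_A Q t r * r)
   + kappa * r / (2 * f_A Q t r) * (fT T11 p Q t r - fT T00 p Q t r))).
Proof.
  pose proof (locally_singleton _ _ HOm) as Hin.
  pose proof (cl_M _ _ _ _ HQ t r Hin) as DM.
  destruct (cl_B _ _ _ _ HQ t r Hin) as [EB DB].
  pose proof (locally_singleton _ _ HM) as HA0. simpl in HA0.
  assert (DA : is_derive (f_A Q t) r ((1 - f_A Q t r) / r - kappa * r * fT T00 p Q t r)).
  { apply (is_derive_ext_loc (fun x => 1 - 2 * f_M Q t x / x)).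
    { revert HM. apply filter_imp. intros x Hx. now symmetry. }
    auto_derive.
    - split; [eexists; exact DM|split; [lra|trivial]].
    - replace (Derive (fun x : R => f_M Q t x) r) with (1 / 2 * kappa * r ^ 2 * fT T00 p Q t r)
        by (symmetry; exact (is_derive_unique _ _ _ DM)).
      rewrite HA0. field. lra. }
  assert (HAB : 0 < f_A Q t r * f_B Q t r) by now apply Rmult_lt_0_compat.
  assert (DB' : is_derive (f_B Q t) r (f_B Q t r * ((1 - f_A Q t r) / (f_A Q t r * r)
      + kappa * r / f_A Q t r * fT T11 p Q t r))).
  { rewrite <- DB. replace (_ * _) with (D2 (f_B Q) t r) by (field; lra).
    exact (Derive_correct _ _ EB). }
  pose proof (sqrt_lt_R0 _ HAB) as HC. pose proof (sqrt_sqrt _ (Rlt_le _ _ HAB)) as HC2.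
  unfold fsqrtAB. auto_derive.
  - repeat split; try (eexists; eassumption). assumption.
  - replace (Derive (fun x : R => f_A Q t x) r) with ((1 - f_A Q t r) / r - kappa * r * fT T00 p Q t r)
      by (symmetry; exact (is_derive_unique _ _ _ DA)).
    replace (Derive (fun x : R => f_B Q t x) r) with (f_B Q t r * ((1 - f_A Q t r) / (f_A Q t r * r)
      + kappa * r / f_A Q t r * fT T11 p Q t r))
      by (symmetry; exact (is_derive_unique _ _ _ DB')).
    set (C := sqrt (f_A Q t r * f_B Q t r)) in *.
    apply (Rmult_eq_reg_r (2 * C)); [|lra].
    transitivity ((C * C) * (2 * ((1 - f_A Q t r) / (f_A Q t r * r)
      + kappa * r / (2 * f_A Q t r) * (fT T11 p Q t r - fT T00 p Q t r)))); [|ring].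
    rewrite HC2. field. lra.
Qed.

(** [(c_s / (rho + p), 1 / (1 - v^2))] is the left eigenvector of the system for the speed
    [lambda_+], so this combination of the balance laws differentiates only in that direction. *)
Lemma characteristic_form :
  coef_a p (f_rho Q t r) * D1 (f_rho Q) t r + coef_b (f_v Q t r) * D1 (f_v Q) t r
  + flam_plus p Q t r
    * (coef_a p (f_rho Q t r) * D2 (f_rho Q) t r + coef_b (f_v Q t r) * D2 (f_v Q) t r)
  = s_minus p kappa (f_A Q t r) (f_B Q t r) r (f_rho Q t r) (f_v Q t r).
Proof.
  pose proof (locally_singleton _ _ HOm) as Hin.
  destruct (cl_rho _ _ _ _ HQ _ Hin) as (R1 & R2 & _).
  destruct (cl_v _ _ _ _ HQ _ Hin) as (V1 & V2 & _). simpl in R1, R2, V1, V2.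
  apply Derive_correct in R1, R2, V1, V2.
  pose proof (cl_energy _ _ _ _ HQ _ _ Hin) as En.
  pose proof (cl_momentum _ _ _ _ HQ _ _ Hin) as Mo.
  pose proof is_derive_fsqrtAB as DC.
  destruct (physical_bounds p Hp _ _ Hph) as (HE & Hn & Hm & Hq & Hd).
  destruct (cs_bounds p Hp _ (proj1 Hph)) as [_ Hc].
  pose proof (proj2 Hph) as Hv.
  assert (E1 : D1 (fT T00 p Q) t r = _)
    by exact (is_derive_unique _ _ _ (is_derive_T00 p Hp
        (fun s => f_rho Q s r) (fun s => f_v Q s r) t _ _ Hph R1 V1)).
  assert (E2 : D1 (fT T01 p Q) t r = _)
    by exact (is_derive_unique _ _ _ (is_derive_T01 p Hp
        (fun s => f_rho Q s r) (fun s => f_v Q s r) t _ _ Hph R1 V1)).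
  assert (E3 : D2 (fun t' r' => fsqrtAB Q t' r' * fT T01 p Q t' r') t r = _)
    by exact (is_derive_unique _ _ _ (is_derive_mult (fun s => fsqrtAB Q t s) _ _ _ _ DC
        (is_derive_T01 p Hp
        (fun s => f_rho Q t s) (fun s => f_v Q t s) r _ _ Hph R2 V2) Rmult_comm)).
  assert (E4 : D2 (fun t' r' => fsqrtAB Q t' r' * fT T11 p Q t' r') t r = _)
    by exact (is_derive_unique _ _ _ (is_derive_mult (fun s => fsqrtAB Q t s) _ _ _ _ DC
        (is_derive_T11 p Hp
        (fun s => f_rho Q t s) (fun s => f_v Q t s) r _ _ Hph R2 V2) Rmult_comm)).
  rewrite E1, E3 in En. rewrite E2, E4 in Mo. clear E1 E2 E3 E4.
  unfold plus, mult in En, Mo; simpl in En, Mo.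
  unfold S0, S1, fT in *. rewrite (T00_eq p), (T01_eq p), (T11_eq p) in En, Mo by assumption.
  unfold T00_rho, T01_rho, T11_rho, T00_v, T01_v in *. rewrite <- Hc in En, Mo.
  unfold flam_plus, lam_plus, s_minus, coef_a, coef_b, H1, H2.
  fold (fsqrtAB Q t r) in *.
  set (C := fsqrtAB Q t r) in *. set (c := cs p (f_rho Q t r)) in *.
  apply (characteristic_combination C c kappa); try lra.
  - exact En.
  - exact Mo.
Qed.

End Characteristic.

(** * Paths close to the edge of a region *)

Lemma at_right_segment (d : R) : 0 < d -> at_right 0 (fun t => 0 < t < d).
Proof.
  intros Hd. exists (mkposreal d Hd). intros t Ht Ht0. change (Rabs (t - 0) < d) in Ht.
  rewrite Rminus_0_r in Ht. apply Rabs_def2 in Ht. lra.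
Qed.

Lemma at_left_segment (a : R) : a < 0 -> at_left 0 (fun t => a < t < 0).
Proof.
  intros Ha. assert (Ha' : 0 < - a) by lra.
  exists (mkposreal _ Ha'). intros t Ht Ht0. change (Rabs (t - 0) < - a) in Ht.
  rewrite Rminus_0_r in Ht. apply Rabs_def2 in Ht. lra.
Qed.

Lemma at_right_inv (P : R -> Prop) : at_right 0 P -> exists d, 0 < d /\ forall t, 0 < t < d -> P t.
Proof.
  intros [d Hd]. exists d. split; [apply cond_pos|]. intros t Ht. apply Hd; [|lra].
  change (Rabs (t - 0) < d). rewrite Rminus_0_r, Rabs_pos_eq; lra.
Qed.

Lemma lim_Rabs_le {X} (F : (X -> Prop) -> Prop) {FF : ProperFilter F} (h : X -> R) (l e : R) :
  F (fun x => Rabs (h x) <= e) -> filterlim h F (locally l) -> Rabs l <= e.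
Proof.
  intros He Hl. apply Rnot_lt_le. intros Hlt.
  assert (Hd : 0 < Rabs l - e) by lra.
  generalize (filter_and _ _ He (proj1 (filterlim_locally _ _) Hl (mkposreal _ Hd))).
  intros HF. destruct (filter_ex _ HF) as (x & Hx1 & Hx2).
  change (Rabs (h x - l) < Rabs l - e) in Hx2.
  pose proof (Rabs_triang (h x) (- (h x - l))) as Ht. rewrite Rabs_Ropp in Ht.
  replace (h x + - (h x - l)) with l in Ht by ring. lra.
Qed.

Lemma continuous_slice2 (f : R -> R -> R) (x y : R) :
  continuous (uncurry f) (x, y) -> continuous (fun s => f x s) y.
Proof.
  intros H P HP. destruct (H P HP) as [e He]. exists e. intros s Hs.
  apply (He (x, s)). split; [apply ball_center|exact Hs].
Qed.

(** ** Derivatives along the edge *)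

Section Edge.
Variables (Om : R * R -> Prop) (r0 tau : R) (chi eta chi' eta' : R -> R) (m m' : R).
Hypothesis Htau : 0 < tau.
Hypothesis Hchi : forall t, 0 < t < tau -> is_derive chi t (chi' t).
Hypothesis Heta : forall t, 0 < t < tau -> is_derive eta t (eta' t).
Hypothesis Hchi0 : filterlim chi (at_right 0) (locally r0).
Hypothesis Heta0 : filterlim eta (at_right 0) (locally r0).
Hypothesis Hin : forall t th, 0 < t < tau -> 0 < th < 1 ->
  Om (t, chi t + th * (eta t - chi t)).

Let F2 := filter_prod (at_right 0) (at_right 0).

(** The paths interpolate between the edge ([th = 0]) and an auxiliary curve in the region.
    Treating the position along the path and [th] as a joint limit makes the estimates on
    all paths close to the edge uniform. *)
Lemma filterlim_paths :
  filterlim (fun z : R * R => (fst z, chi (fst z) + snd z * (eta (fst z) - chi (fst z)))) F2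
    (within Om (locally (0, r0))).
Proof.
  intros P [e He].
  assert (N1 : at_right 0 (fun t => ball 0 e t)) by (exists e; intros t Ht _; exact Ht).
  assert (N2 := proj1 (filterlim_locally _ _) Hchi0 e).
  assert (N3 := proj1 (filterlim_locally _ _) Heta0 e).
  apply (Filter_prod _ _ _ (fun t => (0 < t < tau /\ ball 0 e t) /\ (ball r0 e (chi t) /\ ball r0 e (eta t)))
    (fun th => 0 < th < 1)).
  - apply filter_and; apply filter_and; try assumption. now apply at_right_segment.
  - apply at_right_segment, Rlt_0_1.
  - intros t th [[Ht B0] [B1 B2]] Hth. apply He; [|now apply Hin].
    split; [exact B0|]. simpl.
    change (Rabs (chi t - r0) < e) in B1. change (Rabs (eta t - r0) < e) in B2.
    change (Rabs (chi t + th * (eta t - chi t) - r0) < e).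
    apply Rabs_def2 in B1, B2. apply Rabs_def1; nra.
Qed.

Section Field.
Variables (f : R -> R -> R).
Hypothesis Hcont : forall t, 0 < t < tau -> continuous (uncurry f) (t, chi t).

Lemma edge_value t : 0 < t < tau ->
  filterlim (fun th => f t (chi t + th * (eta t - chi t))) (at_right 0) (locally (f t (chi t))).
Proof.
  intros Ht.
  apply (lim_comp _ (fun r => f t r)); [exact (continuous_slice2 f _ _ (Hcont t Ht))|].
  assert (L : filterlim (fun th => chi t + th * (eta t - chi t)) (at_right 0)
    (locally (chi t + 0 * (eta t - chi t)))).
  { apply lim_plus; [apply at_right_proper_filter|apply filterlim_const|].
    apply lim_mult; [apply at_right_proper_filter| |apply filterlim_const].
    apply lim_within; [apply locally_filter|]. exact (filterlim_id _ _). }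
  rewrite Rmult_0_l, Rplus_0_r in L. exact L.
Qed.

Lemma edge_limit l : tends Om f (0, r0) l ->
  filterlim (fun t => f t (chi t)) (at_right 0) (locally l).
Proof.
  intros Hf. apply filterlim_locally. intros e.
  pose proof (filterlim_comp _ _ _ _ _ _ _ _ filterlim_paths Hf) as H2.
  destruct (proj1 (filterlim_locally _ _) H2 (pos_div_2 e)) as [P P' HP HP' H].
  generalize (filter_and _ _ HP (at_right_segment _ Htau)). apply filter_imp.
  intros t [Ht Ht']. change (Rabs (f t (chi t) - l) < e).
  apply Rle_lt_trans with (pos_div_2 e); [|simpl; destruct e as [e He]; simpl; lra].
  apply (lim_Rabs_le (at_right 0) (fun th => f t (chi t + th * (eta t - chi t)) - l)).
  - revert HP'. apply filter_imp. intros th Hth. left. exact (H t th Ht Hth).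
  - apply lim_minus; [apply at_right_proper_filter|now apply edge_value|apply filterlim_const].
Qed.

Hypothesis Hopen : forall q, Om q -> locally q Om.
Hypothesis HC1 : C1_on Om f.
Variables l1 l2 : R.
Hypotheses (Hl1 : tends Om (D1 f) (0, r0) l1) (Hl2 : tends Om (D2 f) (0, r0) l2).
Hypothesis Hm : filterlim chi' (at_right 0) (locally m).
Hypothesis Hm' : filterlim eta' (at_right 0) (locally m').

(** The mean value theorem on an interior path, whose slope is close to [l1 + m l2], passes to
    the edge as [th] tends to zero because [f] is continuous there. *)
Lemma edge_increment (e : R) : 0 < e -> exists d, 0 < d /\
  forall s t, 0 < s < d -> 0 < t < d ->
    Rabs (f t (chi t) - f s (chi s) - (t - s) * (l1 + m * l2)) <= e * Rabs (t - s).
Proof.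
  intros He.
  set (path := fun t th => chi t + th * (eta t - chi t)).
  set (path' := fun t th => chi' t + th * (eta' t - chi' t)).
  set (slope := fun t th => D1 f t (path t th) * 1 + D2 f t (path t th) * path' t th).
  assert (FF : Filter F2) by (apply filter_prod_filter; apply at_right_proper_filter).
  assert (LS : filterlim (uncurry slope) F2 (locally (l1 * 1 + l2 * (m + 0 * (m' - m))))).
  { assert (L1 : filterlim (fun z => chi' (fst z)) F2 (locally m))
      by exact (filterlim_comp _ _ _ fst chi' _ _ _ filterlim_fst Hm).
    assert (L2 : filterlim (fun z => eta' (fst z)) F2 (locally m'))
      by exact (filterlim_comp _ _ _ fst eta' _ _ _ filterlim_fst Hm').
    assert (L0 : filterlim (fun z : R * R => snd z) F2 (locally 0)).
    { apply (filterlim_comp _ _ _ snd (fun x => x) _ (at_right 0)); [apply filterlim_snd|].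
      apply lim_within; [apply locally_filter|]. exact (filterlim_id _ _). }
    unfold slope, path', uncurry.
    apply lim_plus; [assumption| |].
    - apply lim_mult; [assumption| |apply filterlim_const].
      exact (filterlim_comp _ _ _ _ _ _ _ _ filterlim_paths Hl1).
    - apply lim_mult; [assumption| |].
      + exact (filterlim_comp _ _ _ _ _ _ _ _ filterlim_paths Hl2).
      + apply lim_plus; [assumption|assumption|].
        apply lim_mult; [assumption|assumption|]. now apply lim_minus. }
  destruct (proj1 (filterlim_locally _ _) LS (mkposreal e He)) as [P P' HP HP' H].
  destruct (at_right_inv _ (filter_and _ _ HP (at_right_segment _ Htau))) as (d & Hd & HPd).
  exists d. split; [assumption|]. intros s t Hs Ht.
  apply (lim_Rabs_le (at_right 0)
    (fun th => f t (path t th) - f s (path s th) - (t - s) * (l1 + m * l2))).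
  - generalize (filter_and _ _ HP' (at_right_segment _ Rlt_0_1)). apply filter_imp.
    intros th [Hth Hth1].
    assert (HD : forall x, 0 < x < d -> is_derive (fun x => f x (path x th)) x (slope x th)).
    { intros x Hx. destruct (HPd x Hx) as [Px Hx'].
      apply (is_derive_along f (fun x => x) (fun x => path x th)).
      - generalize (Hopen _ (Hin x th Hx' Hth1)). apply filter_imp. exact HC1.
      - exact (is_derive_id x).
      - unfold path, path'. pose proof (Hchi x Hx') as DC. pose proof (Heta x Hx') as DE.
        auto_derive; [repeat split; eexists; eassumption|].
        replace (Derive (fun y : R => chi y) x) with (chi' x) by (symmetry; exact (is_derive_unique _ _ _ DC)).
        replace (Derive (fun y : R => eta y) x) with (eta' x) by (symmetry; exact (is_derive_unique _ _ _ DE)).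
        ring. }
    assert (Hst : forall x, Rmin s t <= x <= Rmax s t -> 0 < x < d).
    { intros x [X1 X2]. split; [apply Rlt_le_trans with (2 := X1); apply Rmin_glb_lt; lra|].
      apply Rle_lt_trans with (1 := X2). apply Rmax_lub_lt; lra. }
    destruct (MVT_gen (fun x => f x (path x th)) s t (fun x => slope x th)) as (x & Hx & Hmvt).
    + intros x Hx. apply HD, Hst. lra.
    + intros x Hx. apply continuity_pt_filterlim.
      apply (ex_derive_continuous (fun x => f x (path x th))). eexists. apply HD, Hst, Hx.
    + rewrite Hmvt. replace (_ - _) with ((slope x th - (l1 * 1 + l2 * (m + 0 * (m' - m)))) * (t - s)) by ring.
      rewrite Rabs_mult. apply Rmult_le_compat_r; [apply Rabs_pos|].
      left. exact (H x th (proj1 (HPd x (Hst x Hx))) Hth).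
  - destruct (HPd s Hs) as [_ Hs']. destruct (HPd t Ht) as [_ Ht'].
    apply lim_minus; [apply at_right_proper_filter| |apply filterlim_const].
    apply lim_minus; [apply at_right_proper_filter|now apply edge_value|now apply edge_value].
Qed.

(** The values of [f] on the edge are a function [F] of a parameter [a] for which the
    time on the edge is [tc a]; the chain rule then holds at the corner, where [f]
    itself has no derivative. *)
Lemma edge_chart_derivative (a0 tc' F' : R) (tc F : R -> R) :
  a0 < 0 -> tc 0 = 0 -> is_derive tc 0 tc' -> is_derive F 0 F' ->
  (forall a, a0 < a < 0 -> 0 < tc a /\ F a = f (tc a) (chi (tc a))) ->
  F' = tc' * (l1 + m * l2).
Proof.
  intros Ha0 Htc0 Dtc DF HF.
  set (L := l1 + m * l2).
  assert (Ctc : filterlim tc (at_left 0) (locally 0)).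
  { rewrite <- Htc0 at 2. apply lim_within; [apply locally_filter|].
    apply (ex_derive_continuous tc). now exists tc'. }
  assert (CF : filterlim F (at_left 0) (locally (F 0))).
  { apply lim_within; [apply locally_filter|]. apply (ex_derive_continuous F). now exists F'. }
  (* Let the earlier point tend to the corner, then divide by the parameter. *)
  assert (HE : forall e, 0 < e -> Rabs (F' - tc' * L) <= e * Rabs tc').
  { intros e He. destruct (edge_increment e He) as (d & Hd & Hinc).
    assert (N : at_left 0 (fun a => a0 < a < 0 /\ 0 < tc a < d)).
    { generalize (filter_and _ _ (at_left_segment _ Ha0)
        (proj1 (filterlim_locally _ _) Ctc (mkposreal d Hd))).
      apply filter_imp. intros a [Ha Hda]. change (Rabs (tc a - 0) < d) in Hda.
      destruct (HF a Ha) as [Hta _]. rewrite Rminus_0_r, Rabs_pos_eq in Hda; lra. }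
    assert (H0 : at_left 0 (fun a => a < 0 /\ Rabs (F a - F 0 - (tc a - 0) * L) <= e * Rabs (tc a - 0))).
    { generalize N. apply filter_imp. intros a [Ha Hta]. split; [lra|].
      apply Rminus_le_0.
      apply Rnot_lt_le. intros Hlt.
      set (g := fun b => e * Rabs (tc a - tc b) - Rabs (F a - F b - (tc a - tc b) * L)).
      assert (Cg : filterlim g (at_left 0)
        (locally (e * Rabs (tc a - 0) - Rabs (F a - F 0 - (tc a - 0) * L)))).
      { assert (CA : forall x, continuous Rabs x) by apply continuous_Rabs.
        assert (FL : Filter (at_left 0)) by apply at_left_proper_filter.
        apply lim_minus; [assumption| |].
        - apply lim_mult; [assumption|apply filterlim_const|].
          apply (lim_comp _ Rabs); [apply CA|]. apply lim_minus; [assumption|apply filterlim_const|assumption].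
        - apply (lim_comp _ Rabs); [apply CA|].
          apply lim_minus; [assumption|apply lim_minus; [assumption|apply filterlim_const|assumption]|].
          apply lim_mult; [assumption| |apply filterlim_const].
          apply lim_minus; [assumption|apply filterlim_const|assumption]. }
      generalize (filter_and _ _ N (Cg (fun z => z < 0) (open_lt 0 _ Hlt))).
      intros HN. destruct (filter_ex _ HN) as (b & [Hb Htb] & Hgb). unfold g in Hgb.
      pose proof (Hinc (tc b) (tc a) Htb Hta) as Hab. fold L in Hab.
      rewrite <- (proj2 (HF a Ha)), <- (proj2 (HF b Hb)) in Hab. lra. }
    pose proof (left_quotient _ _ _ DF) as QF. pose proof (left_quotient _ _ _ Dtc) as Qt.
    rewrite Htc0 in Qt.
    apply Rminus_le_0. apply Rnot_lt_le. intros Hlt.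
    assert (FL : Filter (at_left 0)) by apply at_left_proper_filter.
    assert (Cg : filterlim (fun a => e * Rabs ((tc a - 0) / (a - 0)) - Rabs ((F a - F 0) / (a - 0) - (tc a - 0) / (a - 0) * L))
      (at_left 0) (locally (e * Rabs tc' - Rabs (F' - tc' * L)))).
    { apply lim_minus; [assumption| |].
      - apply lim_mult; [assumption|apply filterlim_const|].
        apply (lim_comp _ Rabs); [apply continuous_Rabs|assumption].
      - apply (lim_comp _ Rabs); [apply continuous_Rabs|].
        apply lim_minus; [assumption|assumption|].
        apply lim_mult; [assumption|assumption|apply filterlim_const]. }
    generalize (filter_and _ _ H0 (Cg (fun z => z < 0) (open_lt 0 _ Hlt))).
    intros HN. destruct (filter_ex _ HN) as (a & [Ha Hle] & Hgt).
    assert (Ha' : 0 < / Rabs a) by (apply Rinv_0_lt_compat, Rabs_pos_lt; lra).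
    replace ((F a - F 0) / (a - 0) - (tc a - 0) / (a - 0) * L) with ((F a - F 0 - (tc a - 0) * L) / a) in Hgt
      by (field; lra).
    rewrite (Rminus_0_r a) in Hgt.
    rewrite !Rabs_div in Hgt by lra. unfold Rdiv in Hgt. nra. }
  apply cond_eq. intros e He.
  assert (Hq : 0 < e / (Rabs tc' + 1)) by (apply Rdiv_lt_0_compat; pose proof (Rabs_pos tc'); lra).
  apply Rle_lt_trans with (1 := HE _ Hq).
  apply Rlt_le_trans with (e / (Rabs tc' + 1) * (Rabs tc' + 1)).
  - apply Rmult_lt_compat_l; lra.
  - right. field. pose proof (Rabs_pos tc'). lra.
Qed.

End Field.
End Edge.

(** * Lipschitz metrics and initial slopes *)

Lemma tends_subset (K K' : R * R -> Prop) f P l : (forall q, K' q -> K q) ->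
  tends K f P l -> tends K' f P l.
Proof.
  intros HK Hf V HV. generalize (Hf V HV). unfold filtermap, within.
  apply filter_imp. intros q Hq Kq. now apply Hq, HK.
Qed.

Lemma lipschitz_tends (K : R * R -> Prop) f (x y : R) :
  locally_lipschitz_on K f -> K (x, y) -> tends K f (x, y) (f x y).
Proof.
  intros Hlip HK. destruct (Hlip _ HK) as (eps & L & Heps & HL).
  apply filterlim_locally. intros e.
  set (d := Rmin eps (e / (2 * (Rabs L + 1)))).
  assert (HL0 := Rabs_pos L).
  assert (Hd : 0 < d).
  { apply Rmin_glb_lt; [assumption|]. apply Rdiv_lt_0_compat; [apply cond_pos|lra]. }
  assert (Hd1 : d <= eps) by apply Rmin_l.
  assert (Hd2 : d <= e / (2 * (Rabs L + 1))) by apply Rmin_r.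
  exists (mkposreal d Hd). intros q [B1 B2] Kq. simpl in B1, B2.
  change (Rabs (fst q - x) < d) in B1. change (Rabs (snd q - y) < d) in B2.
  change (Rabs (uncurry f q - uncurry f (x, y)) < e).
  eapply Rle_lt_trans.
  { apply HL; [assumption|assumption| |].
    - split; change (Rabs (fst q - x) < eps) || change (Rabs (snd q - y) < eps); lra.
    - split; apply ball_center || (change (Rabs (x - x) < eps) || change (Rabs (y - y) < eps));
      rewrite Rminus_diag, Rabs_R0; assumption. }
  simpl. apply Rle_lt_trans with (Rabs L * (d + d)).
  { apply Rle_trans with (Rabs L * (Rabs (fst q - x) + Rabs (snd q - y))).
    - apply Rmult_le_compat_r; [|apply Rle_abs].
      pose proof (Rabs_pos (fst q - x)); pose proof (Rabs_pos (snd q - y)); lra.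
    - apply Rmult_le_compat_l; lra. }
  apply Rlt_le_trans with (2 * (Rabs L + 1) * d); [nra|].
  apply Rle_trans with (2 * (Rabs L + 1) * (e / (2 * (Rabs L + 1)))).
  - apply Rmult_le_compat_l; lra.
  - right. field. lra.
Qed.

(** The mean value theorem is applied on a short segment at positive times, which then
    tend to zero; the segment itself stays away from the corner. *)
Lemma initial_slope (Om : R * R -> Prop) (U : R -> R -> R) (r0 delta u0 u' m : R) :
  0 < delta ->
  (forall r, r0 - delta < r < r0 -> U 0 r = u0 + (r - r0) * u') ->
  (forall r, r0 - delta < r < r0 -> filterlim (fun t => U t r) (at_right 0) (locally (U 0 r))) ->
  (forall r1 r2, r0 - delta < r1 -> r1 < r2 < r0 ->
    at_right 0 (fun t => forall r, r1 <= r <= r2 -> Om (t, r))) ->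
  (forall t r, Om (t, r) -> ex_derive (fun s => U t s) r) ->
  tends Om (D2 U) (0, r0) m -> u' = m.
Proof.
  intros Hdelta H0 Ht0 Hin Hex Hm. apply cond_eq. intros e He.
  assert (He2 : 0 < e / 2) by lra.
  destruct (proj1 (filterlim_locally _ _) Hm (mkposreal _ He2)) as [d Hd].
  pose proof (cond_pos d) as Hd0.
  set (h := Rmin (d / 2) (delta / 2)).
  assert (Hh : 0 < h) by (apply Rmin_glb_lt; lra).
  assert (Hh1 : h <= d / 2) by apply Rmin_l.
  assert (Hh2 : h <= delta / 2) by apply Rmin_r.
  set (r1 := r0 - h). set (r2 := r0 - h / 2).
  assert (Hr1 : r0 - delta < r1 < r0) by (unfold r1; lra).
  assert (Hr2 : r0 - delta < r2 < r0) by (unfold r2; lra).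
  assert (Hr12 : r1 < r2) by (unfold r1, r2; lra).
  assert (HB : Rabs (U 0 r2 - U 0 r1 - m * (r2 - r1)) <= e / 2 * (r2 - r1)).
  { apply (lim_Rabs_le (at_right 0) (fun t => U t r2 - U t r1 - m * (r2 - r1))).
    - generalize (filter_and _ _ (at_right_segment _ Hd0) (Hin r1 r2 (proj1 Hr1) (conj Hr12 (proj2 Hr2)))).
      apply filter_imp. intros t [Ht HOm].
      destruct (MVT_gen (fun s => U t s) r1 r2 (fun s => D2 U t s)) as (x & Hx & Hmvt).
      + rewrite Rmin_left, Rmax_right by lra. intros x Hx. apply Derive_correct, Hex, HOm. lra.
      + rewrite Rmin_left, Rmax_right by lra. intros x Hx. apply continuity_pt_filterlim.
        apply (ex_derive_continuous (fun s => U t s)). apply Hex, HOm. lra.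
      + rewrite Rmin_left, Rmax_right in Hx by lra. rewrite Hmvt.
        replace (_ - _) with ((D2 U t x - m) * (r2 - r1)) by ring.
        rewrite Rabs_mult, (Rabs_pos_eq (r2 - r1)) by lra.
        apply Rmult_le_compat_r; [lra|]. left. apply (Hd (t, x)); [|apply HOm; lra].
        split; [change (Rabs (t - 0) < d)|change (Rabs (x - r0) < d)];
          apply Rabs_def1; unfold r1, r2 in *; lra.
    - apply lim_minus; [apply at_right_proper_filter| |apply filterlim_const].
      apply lim_minus; [apply at_right_proper_filter|apply Ht0|apply Ht0]; assumption. }
  rewrite !H0 in HB by assumption.
  replace (_ - _ - _) with ((u' - m) * (r2 - r1)) in HB by ring.
  rewrite Rabs_mult, (Rabs_pos_eq (r2 - r1)) in HB by lra.
  apply Rmult_le_reg_r in HB; lra.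
Qed.

(** Cramer's rule applies because the determinant of [dU / d(rho, v)] is
    [(rho + p) (1 - v^2 c_s^2) / (1 - v^2)^2 > 0]. *)
Lemma primitive_slope_unique p rho v (U' : R * R) rho' v' : eos p -> physical rho v ->
  fst U' = T00_rho p rho v * rho' + T00_v p rho v * v' ->
  snd U' = T01_rho p rho v * rho' + T01_v p rho v * v' ->
  primitive_slope p rho v U' = (rho', v').
Proof.
  intros Hp Hph E0 E1. destruct (physical_bounds p Hp _ _ Hph) as (HE & Hn & _ & _ & Hd).
  destruct (cs_bounds p Hp _ (proj1 Hph)) as [_ Hc].
  assert (D : forall (T : (R -> R) -> R -> R -> R) Tr Tv,
    (forall (rho v : R -> R) (x rho' v' : R), physical (rho x) (v x) ->
      is_derive rho x rho' -> is_derive v x v' ->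
      is_derive (fun s => T p (rho s) (v s)) x (Tr (rho x) (v x) * rho' + Tv (rho x) (v x) * v')) ->
    Derive (fun x => T p x v) rho = Tr rho v /\ Derive (fun y => T p rho y) v = Tv rho v).
  { intros T Tr Tv HT. split; apply is_derive_unique.
    - replace (Tr rho v) with (Tr rho v * 1 + Tv rho v * 0) by ring.
      apply (HT (fun s => s) (fun _ => v)); [assumption|exact (is_derive_id rho)|exact (is_derive_const v rho)].
    - replace (Tv rho v) with (Tr rho v * 0 + Tv rho v * 1) by ring.
      apply (HT (fun _ => rho) (fun s => s)); [assumption|exact (is_derive_const rho v)|exact (is_derive_id v)]. }
  destruct (D T00 _ _ (is_derive_T00 p Hp)) as [D1 D2].
  destruct (D T01 _ _ (is_derive_T01 p Hp)) as [D3 D4].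
  unfold primitive_slope. rewrite D1, D2, D3, D4, E0, E1.
  assert (Hdet : T00_rho p rho v * T01_v p rho v - T00_v p rho v * T01_rho p rho v <> 0).
  { replace (_ - _) with ((rho + p rho) * (1 - v ^ 2 * cs p rho ^ 2) / (1 - v ^ 2) ^ 2).
    - apply Rgt_not_eq, Rdiv_lt_0_compat; [|nra]. now apply Rmult_lt_0_compat.
    - rewrite Hc. unfold T00_rho, T01_v, T00_v, T01_rho. field. lra. }
  f_equal; field; assumption.
Qed.

(** * Limits at the corner from the smooth regions *)

Ltac lim_sums := repeat first
  [ assumption
  | lazymatch goal with
    | |- filterlim _ _ (locally (_ + _)) => apply lim_plus
    | |- filterlim _ _ (locally (_ * _)) => apply lim_mult
    end ].

Section GRP.
Variables (p : R -> R) (kappa r0 : R) (UL UR UL' UR' : R * R) (rhoL vL rhoR vR : R)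
  (wrho wv : R -> R) (rhoS vS sig : R) (Q : flow) (T delta : R) (chiL chiS shock : R -> R).
Hypothesis Hp : eos p.
Hypothesis G : grp_solution p kappa r0 UL UR UL' UR' rhoL vL rhoR vR wrho wv rhoS vS sig
  Q T delta chiL chiS shock.

Let As := f_A Q 0 r0.
Let Bs := f_B Q 0 r0.
Let D := dom r0 T delta.

Lemma corner_in_dom : D (0, r0).
Proof.
  pose proof (of_grp gs_T G).
  pose proof (of_grp gs_delta G).
  unfold D, dom; simpl; lra.
Qed.

Lemma corner_metric_pos : 0 < As /\ 0 < Bs.
Proof.
  destruct ((of_grp gs_metric G) _ _ corner_in_dom) as (HA & HB & _).
  now split.
Qed.

Lemma dom_r_pos t r : D (t, r) -> 0 < r.
Proof.
  pose proof (of_grp gs_delta G).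
  unfold D, dom; simpl; lra.
Qed.

Section Region.
Variable Om : R * R -> Prop.
Hypothesis HQ : classical_solution p kappa Q Om.
Hypothesis Hsub : forall q, Om q -> D q.
Hypothesis Hopen : forall q, Om q -> locally q Om.

Lemma region_characteristic_form t r : Om (t, r) ->
  coef_a p (f_rho Q t r) * D1 (f_rho Q) t r + coef_b (f_v Q t r) * D1 (f_v Q) t r
  + flam_plus p Q t r
    * (coef_a p (f_rho Q t r) * D2 (f_rho Q) t r + coef_b (f_v Q t r) * D2 (f_v Q) t r)
  = s_minus p kappa (f_A Q t r) (f_B Q t r) r (f_rho Q t r) (f_v Q t r).
Proof.
  intros Hin. pose proof (Hsub _ Hin) as HD.
  destruct ((of_grp gs_metric G) _ _ HD) as (HA & HB & _).
  apply (characteristic_form p kappa Q Om); try assumption.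
  - now apply (dom_r_pos t).
  - now apply Hopen.
  - exact ((of_grp gs_phys G) _ _ HD).
  - assert (HL : locally r (fun x => r0 - delta < x < r0 + delta)).
    { apply (open_and (fun x => r0 - delta < x) (fun x => x < r0 + delta)); [apply open_gt|apply open_lt|].
      exact (proj2 HD). }
    revert HL. apply filter_imp. intros x Hx.
    apply ((of_grp gs_metric G) t x). split; [apply HD|exact Hx].
Qed.

Variables (gam : R -> R) (tau rho0 v0 rt rr vt vr : R).
Hypothesis Htau : 0 < tau.
Hypothesis Hgam : filterlim gam (at_right 0) (locally r0).
Hypothesis Hgam_in : forall t, 0 < t < tau -> Om (t, gam t).
Hypothesis Hph : physical rho0 v0.
Hypotheses (Lrho : tends Om (f_rho Q) (0, r0) rho0) (Lv : tends Om (f_v Q) (0, r0) v0)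
  (Lrt : tends Om (D1 (f_rho Q)) (0, r0) rt) (Lrr : tends Om (D2 (f_rho Q)) (0, r0) rr)
  (Lvt : tends Om (D1 (f_v Q)) (0, r0) vt) (Lvr : tends Om (D2 (f_v Q)) (0, r0) vr).

Lemma tends_A : tends Om (f_A Q) (0, r0) As.
Proof.
  apply (tends_subset D); [assumption|]. apply lipschitz_tends; [|exact corner_in_dom].
  exact (of_grp gs_lipA G).
Qed.

Lemma tends_B : tends Om (f_B Q) (0, r0) Bs.
Proof.
  apply (tends_subset D); [assumption|]. apply lipschitz_tends; [|exact corner_in_dom].
  exact (of_grp gs_lipB G).
Qed.

(** The limits exist by assumption; approaching the corner along a curve inside the region
    suffices to carry the relation over to them. *)
Lemma corner_characteristic_form :
  coef_a p rho0 * rt + coef_b v0 * vt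
  + lam_plus p As Bs rho0 v0 * (coef_a p rho0 * rr + coef_b v0 * vr)
  = s_minus p kappa As Bs r0 rho0 v0.
Proof.
  assert (FR : Filter (at_right 0)) by apply at_right_proper_filter.
  assert (AL : forall f l, tends Om f (0, r0) l ->
    filterlim (fun t => f t (gam t)) (at_right 0) (locally l)).
  { intros f l. now apply (tends_along Om f r0 l tau gam). }
  apply AL in Lrho, Lv, Lrt, Lrr, Lvt, Lvr.
  pose proof (AL _ _ tends_A) as LA. pose proof (AL _ _ tends_B) as LB.
  set (lhs := fun t r =>
    coef_a p (f_rho Q t r) * D1 (f_rho Q) t r + coef_b (f_v Q t r) * D1 (f_v Q) t r
    + flam_plus p Q t r
      * (coef_a p (f_rho Q t r) * D2 (f_rho Q) t r + coef_b (f_v Q t r) * D2 (f_v Q) t r)).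
  apply (filterlim_locally_unique (F := at_right 0) (fun t => lhs t (gam t))).
  - pose proof (lim_coef_a p Hp _ _ _ _ Lrho Hph) as La.
    pose proof (lim_coef_b p Hp _ _ _ _ Lv Hph) as Lb.
    unfold lhs. lim_sums. now apply lim_lam_plus.
  - apply (filterlim_ext_loc (fun t => s_minus p kappa (f_A Q t (gam t)) (f_B Q t (gam t)) (gam t)
      (f_rho Q t (gam t)) (f_v Q t (gam t)))).
    + generalize (at_right_segment _ Htau). apply filter_imp. intros t Ht. symmetry.
      now apply region_characteristic_form, Hgam_in.
    + apply lim_s_minus; try assumption; [apply corner_metric_pos|].
      apply (dom_r_pos 0), corner_in_dom.
Qed.

Lemma tends_Dminus_psi_minus rho_ref : 0 < rho_ref ->
  tends Om (Dminus_psi_minus p rho_ref Q) (0, r0)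
    (coef_a p rho0 * rt + coef_b v0 * vt
     + lam_minus p As Bs rho0 v0 * (coef_a p rho0 * rr + coef_b v0 * vr)).
Proof.
  intros Href. assert (FW : Filter (within Om (locally (0, r0)))) by apply within_filter, locally_filter.
  pose proof (lim_coef_a p Hp _ _ _ _ Lrho Hph) as La.
  pose proof (lim_coef_b p Hp _ _ _ _ Lv Hph) as Lb.
  apply (filterlim_within_ext Om (fun q =>
    coef_a p (uncurry (f_rho Q) q) * uncurry (D1 (f_rho Q)) q + coef_b (uncurry (f_v Q) q) * uncurry (D1 (f_v Q)) q
    + lam_minus p (uncurry (f_A Q) q) (uncurry (f_B Q) q) (uncurry (f_rho Q) q) (uncurry (f_v Q) q)
      * (coef_a p (uncurry (f_rho Q) q) * uncurry (D2 (f_rho Q)) q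
         + coef_b (uncurry (f_v Q) q) * uncurry (D2 (f_v Q)) q))).
  - intros [t r] Hin. unfold uncurry; simpl. unfold Dminus_psi_minus.
    pose proof ((of_grp gs_phys G) _ _ (Hsub _ Hin)) as Hq.
    destruct (cl_rho _ _ _ _ HQ _ Hin) as (R1 & R2 & _).
    destruct (cl_v _ _ _ _ HQ _ Hin) as (V1 & V2 & _). simpl in R1, R2, V1, V2.
    apply Derive_correct in R1, R2, V1, V2.
    assert (E1 : D1 (fun t' r' => psi_minus p rho_ref (f_rho Q t' r') (f_v Q t' r')) t r = _)
      by exact (is_derive_unique _ _ _ (is_derive_psi_minus p Hp
        (fun s => f_rho Q s r) (fun s => f_v Q s r) t _ _ Hq R1 V1 _ Href)).
    assert (E2 : D2 (fun t' r' => psi_minus p rho_ref (f_rho Q t' r') (f_v Q t' r')) t r = _)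
      by exact (is_derive_unique _ _ _ (is_derive_psi_minus p Hp
        (fun s => f_rho Q t s) (fun s => f_v Q t s) r _ _ Hq R2 V2 _ Href)).
    rewrite E1, E2. reflexivity.
  - lim_sums.
    apply lim_lam_minus; try assumption; [apply tends_A|apply tends_B].
Qed.

End Region.

Lemma edge_speed_limit (chi : R -> R) (rho0 v0 : R) : physical rho0 v0 ->
  (forall t, 0 < t < T -> D (t, chi t)) -> filterlim chi (at_right 0) (locally r0) ->
  filterlim (fun t => f_rho Q t (chi t)) (at_right 0) (locally rho0) ->
  filterlim (fun t => f_v Q t (chi t)) (at_right 0) (locally v0) ->
  filterlim (fun t => flam_minus p Q t (chi t)) (at_right 0) (locally (lam_minus p As Bs rho0 v0)).
Proof.
  intros Hph HD Hchi Lrho Lv.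
  pose proof (of_grp gs_T G) as HT.
  apply lim_lam_minus; try assumption; [apply at_right_proper_filter| |].
  - apply (tends_along D (f_A Q) r0 As T chi); try assumption. now apply tends_A.
  - apply (tends_along D (f_B Q) r0 Bs T chi); try assumption. now apply tends_B.
Qed.

(** ** The three regions adjacent to the characteristics *)

Lemma is_derive_continuous (f : R -> R) (x l : R) : is_derive f x l -> continuous f x.
Proof. intros H. apply (ex_derive_continuous f). now exists l. Qed.

Lemma edge_order t : 0 < t < T ->
  r0 - delta < chiL t < chiS t /\ chiS t < r0 < shock t /\ shock t < r0 + delta.
Proof. exact ((of_grp gs_order G) t). Qed.

Lemma continuous_chiL t : 0 < t < T -> continuous chiL t.
Proof.
  intros Ht. exact (is_derive_continuous _ _ _ ((of_grp gs_chiL G) t Ht)).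
Qed.

Lemma continuous_chiS t : 0 < t < T -> continuous chiS t.
Proof.
  intros Ht. exact (is_derive_continuous _ _ _ ((of_grp gs_chiS G) t Ht)).
Qed.

Lemma is_derive_shock t : 0 < t < T -> is_derive shock t (Derive shock t).
Proof.
  intros Ht. apply Derive_correct, ((of_grp gs_shock G) t Ht).
Qed.

Lemma left_dom q : left_region r0 T delta chiL q -> D q.
Proof. destruct q as [t r]. intros [Ht Hr]. simpl in Ht, Hr. pose proof (edge_order t Ht). unfold D, dom; simpl; lra. Qed.

Lemma fan_dom q : between T chiL chiS q -> D q.
Proof. destruct q as [t r]. intros [Ht Hr]. simpl in Ht, Hr. pose proof (edge_order t Ht). unfold D, dom; simpl; lra. Qed.

Lemma mid_dom q : between T chiS shock q -> D q.
Proof. destruct q as [t r]. intros [Ht Hr]. simpl in Ht, Hr. pose proof (edge_order t Ht). unfold D, dom; simpl; lra. Qed.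

Lemma left_open q : left_region r0 T delta chiL q -> locally q (left_region r0 T delta chiL).
Proof.
  destruct q as [t r]. intros Hq. apply locally_between; [apply continuous_const| |assumption].
  apply continuous_chiL, (proj1 Hq).
Qed.

Lemma fan_open q : between T chiL chiS q -> locally q (between T chiL chiS).
Proof.
  destruct q as [t r]. intros Hq.
  apply locally_between; [apply continuous_chiL, (proj1 Hq)|apply continuous_chiS, (proj1 Hq)|assumption].
Qed.

Lemma mid_open q : between T chiS shock q -> locally q (between T chiS shock).
Proof.
  destruct q as [t r]. intros Hq.
  apply locally_between; [apply continuous_chiS, (proj1 Hq)| |assumption].
  exact (is_derive_continuous _ _ _ (is_derive_shock t (proj1 Hq))).
Qed.

Lemma continuous_left_edge t : 0 < t < T ->
  continuous (uncurry (f_rho Q)) (t, chiL t) /\ continuous (uncurry (f_v Q)) (t, chiL t).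
Proof.
  intros Ht. pose proof (edge_order t Ht).
  apply (of_grp gs_cont G); unfold dom; simpl; lra.
Qed.

Lemma continuous_mid_edge t : 0 < t < T ->
  continuous (uncurry (f_rho Q)) (t, chiS t) /\ continuous (uncurry (f_v Q)) (t, chiS t).
Proof.
  intros Ht. pose proof (edge_order t Ht).
  apply (of_grp gs_cont G); unfold dom; simpl; lra.
Qed.

Section Edges.
Hypotheses (HphL : physical rhoL vL) (HphS : physical rhoS vS).
Let bL := lam_minus p As Bs rhoL vL.
Let bS := lam_minus p As Bs rhoS vS.

(** The auxiliary curve for the leading edge: it leaves the corner inside the left region. *)
Lemma left_inner_curve : exists tau, 0 < tau <= T /\
  forall t, 0 < t < tau -> r0 - delta < chiL t - t.
Proof.
  pose proof (of_grp gs_T G) as HT. pose proof (of_grp gs_delta G) as Hd.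
  assert (Hd2 : 0 < delta / 2) by lra.
  destruct (at_right_inv _ (filter_and _ _ (at_right_segment _ Hd2)
    (proj1 (filterlim_locally _ _) (of_grp gs_chiL0 G) (mkposreal _ Hd2)))) as (d & Hd0 & H).
  exists (Rmin d T). split; [split; [now apply Rmin_glb_lt|apply Rmin_r]|].
  intros t Ht. pose proof (Rmin_l d T).
  destruct (H t ltac:(lra)) as [Ht1 Ht2]. change (Rabs (chiL t - r0) < delta / 2) in Ht2.
  apply Rabs_def2 in Ht2. lra.
Qed.

Lemma lim_time : filterlim (fun t : R => t) (at_right 0) (locally 0).
Proof. apply lim_within; [apply locally_filter|]. exact (filterlim_id _ _). Qed.

(** Derivative along the leading edge of the fan, seen from the left region; the
    auxiliary curve, with slope less by one, keeps the paths inside that region and close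
    to the corner. *)
Lemma left_edge_chart_derivative f l1 l2 (a0 tc' F' : R) (tc F : R -> R) :
  (forall t, 0 < t < T -> continuous (uncurry f) (t, chiL t)) ->
  C1_on (left_region r0 T delta chiL) f ->
  tends (left_region r0 T delta chiL) (D1 f) (0, r0) l1 ->
  tends (left_region r0 T delta chiL) (D2 f) (0, r0) l2 ->
  a0 < 0 -> tc 0 = 0 -> is_derive tc 0 tc' -> is_derive F 0 F' ->
  (forall a, a0 < a < 0 -> 0 < tc a /\ F a = f (tc a) (chiL (tc a))) ->
  F' = tc' * (l1 + bL * l2).
Proof.
  intros Cf Df L1 L2. destruct left_inner_curve as (tau & Htau & Hin).
  assert (FR : Filter (at_right 0)) by apply at_right_proper_filter.
  set (speed := fun t => flam_minus p Q t (chiL t)).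
  assert (D1c : forall t, 0 < t < tau -> is_derive chiL t (speed t)).
  { intros t Ht. apply (of_grp gs_chiL G). lra. }
  assert (D2c : forall t, 0 < t < tau -> is_derive (fun t => chiL t - t) t (speed t - 1)).
  { intros t Ht. exact (is_derive_minus chiL (fun t => t) t _ _ (D1c t Ht) (is_derive_id t)). }
  assert (L0 : filterlim (fun t => chiL t - t) (at_right 0) (locally r0)).
  { rewrite <- (Rminus_0_r r0). apply lim_minus; [assumption|exact (of_grp gs_chiL0 G)|exact lim_time]. }
  assert (HOm : forall t th, 0 < t < tau -> 0 < th < 1 ->
    left_region r0 T delta chiL (t, chiL t + th * (chiL t - t - chiL t))).
  { intros t th Ht Hth. pose proof (Hin t Ht). split; simpl; nra. }
  destruct (of_grp gs_left_lim G) as (Lrho & Lv & _).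
  assert (EL : forall g l, (forall t, 0 < t < T -> continuous (uncurry g) (t, chiL t)) ->
    tends (left_region r0 T delta chiL) g (0, r0) l ->
    filterlim (fun t => g t (chiL t)) (at_right 0) (locally l)).
  { intros g l Cg. apply (edge_limit _ r0 tau chiL (fun t => chiL t - t)); try assumption; try lra.
    - exact (of_grp gs_chiL0 G).
    - intros t Ht. apply Cg. lra. }
  assert (Ls : filterlim speed (at_right 0) (locally bL)).
  { apply edge_speed_limit; try assumption.
    - intros t Ht. pose proof (edge_order t Ht). unfold D, dom; simpl; lra.
    - exact (of_grp gs_chiL0 G).
    - apply EL; [|assumption]. intros t Ht. now apply continuous_left_edge.
    - apply EL; [|assumption]. intros t Ht. now apply continuous_left_edge. }
  apply (edge_chart_derivative (left_region r0 T delta chiL) r0 tau chiL (fun t => chiL t - t)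
    speed (fun t => speed t - 1) bL (bL - 1)); try assumption; try lra.
  - exact (of_grp gs_chiL0 G).
  - intros t Ht. apply Cf. lra.
  - exact left_open.
  - apply lim_minus; [assumption|assumption|apply filterlim_const].
Qed.

(** On the other side of the fan the shock serves as auxiliary curve. *)
Lemma mid_edge_chart_derivative f l1 l2 (a0 tc' F' : R) (tc F : R -> R) :
  (forall t, 0 < t < T -> continuous (uncurry f) (t, chiS t)) ->
  C1_on (between T chiS shock) f ->
  tends (between T chiS shock) (D1 f) (0, r0) l1 ->
  tends (between T chiS shock) (D2 f) (0, r0) l2 ->
  a0 < 0 -> tc 0 = 0 -> is_derive tc 0 tc' -> is_derive F 0 F' ->
  (forall a, a0 < a < 0 -> 0 < tc a /\ F a = f (tc a) (chiS (tc a))) ->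
  F' = tc' * (l1 + bS * l2).
Proof.
  intros Cf Df L1 L2. pose proof (of_grp gs_T G) as HT.
  assert (FR : Filter (at_right 0)) by apply at_right_proper_filter.
  set (speed := fun t => flam_minus p Q t (chiS t)).
  assert (HOm : forall t th, 0 < t < T -> 0 < th < 1 ->
    between T chiS shock (t, chiS t + th * (shock t - chiS t))).
  { intros t th Ht Hth. pose proof (edge_order t Ht). split; simpl; nra. }
  destruct (of_grp gs_mid_lim G) as (Lrho & Lv & _).
  assert (EL : forall g l, (forall t, 0 < t < T -> continuous (uncurry g) (t, chiS t)) ->
    tends (between T chiS shock) g (0, r0) l ->
    filterlim (fun t => g t (chiS t)) (at_right 0) (locally l)).
  { intros g l Cg. apply (edge_limit _ r0 T chiS shock); try assumption.
    - exact (of_grp gs_chiS0 G).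
    - exact (of_grp gs_shock0 G). }
  assert (Ls : filterlim speed (at_right 0) (locally bS)).
  { apply edge_speed_limit; try assumption.
    - intros t Ht. pose proof (edge_order t Ht). unfold D, dom; simpl; lra.
    - exact (of_grp gs_chiS0 G).
    - apply EL; [|assumption]. intros t Ht. now apply continuous_mid_edge.
    - apply EL; [|assumption]. intros t Ht. now apply continuous_mid_edge. }
  apply (edge_chart_derivative (between T chiS shock) r0 T chiS shock
    speed (Derive shock) bS sig); try assumption.
  - exact (of_grp gs_chiS G).
  - exact is_derive_shock.
  - exact (of_grp gs_chiS0 G).
  - exact (of_grp gs_shock0 G).
  - exact mid_open.
  - apply (of_grp gs_shock_speed G).
Qed.

(** [initial_slope] for the conserved quantities, whose data are affine, and then Cramer's
    rule. *)
Lemma left_slopes rr vr :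
  tends (left_region r0 T delta chiL) (D2 (f_rho Q)) (0, r0) rr ->
  tends (left_region r0 T delta chiL) (D2 (f_v Q)) (0, r0) vr ->
  primitive_slope p rhoL vL UL' = (rr, vr).
Proof.
  intros Lrr Lvr. pose proof (of_grp gs_T G) as HT. pose proof (of_grp gs_delta G) as Hd.
  destruct (of_grp gs_left_lim G) as (Lrho & Lv & _).
  assert (FR : Filter (at_right 0)) by apply at_right_proper_filter.
  assert (FW : Filter (within (left_region r0 T delta chiL) (locally (0, r0))))
    by apply within_filter, locally_filter.
  assert (Hin : forall r1 r2, r0 - delta < r1 -> r1 < r2 < r0 ->
    at_right 0 (fun t => forall r, r1 <= r <= r2 -> left_region r0 T delta chiL (t, r))).
  { intros r1 r2 Hr1 Hr2. assert (He : 0 < r0 - r2) by lra.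
    generalize (filter_and _ _ (at_right_segment _ HT)
      (proj1 (filterlim_locally _ _) (of_grp gs_chiL0 G) (mkposreal _ He))).
    apply filter_imp. intros t [Ht Hc] r Hr. change (Rabs (chiL t - r0) < r0 - r2) in Hc.
    apply Rabs_def2 in Hc. split; simpl; lra. }
  assert (Hphys : forall t r, left_region r0 T delta chiL (t, r) -> physical (f_rho Q t r) (f_v Q t r))
    by (intros t r Hq; apply (of_grp gs_phys G); now apply left_dom).
  assert (H0 : forall r, r0 - delta < r < r0 -> physical (f_rho Q 0 r) (f_v Q 0 r) /\
    filterlim (fun t => f_rho Q t r) (at_right 0) (locally (f_rho Q 0 r)) /\
    filterlim (fun t => f_v Q t r) (at_right 0) (locally (f_v Q 0 r))).
  { intros r Hr.
    destruct (of_grp gs_cont0 G r ltac:(lra) ltac:(lra)) as [C1 C2].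
    split; [apply (of_grp gs_phys G); unfold dom; simpl; lra|].
    split; apply (tends_along D _ r _ T (fun _ => r)); try assumption; try apply filterlim_const;
      intros t Ht; unfold D, dom; simpl; lra. }
  assert (HD : forall (F : (R -> R) -> R -> R -> R) Fr Fv u0 u',
    (forall (rho v : R -> R) (x rho' v' : R), physical (rho x) (v x) ->
      is_derive rho x rho' -> is_derive v x v' ->
      is_derive (fun s => F p (rho s) (v s)) x (Fr (rho x) (v x) * rho' + Fv (rho x) (v x) * v')) ->
    filterlim (fun q => Fr (uncurry (f_rho Q) q) (uncurry (f_v Q) q))
      (within (left_region r0 T delta chiL) (locally (0, r0))) (locally (Fr rhoL vL)) ->
    filterlim (fun q => Fv (uncurry (f_rho Q) q) (uncurry (f_v Q) q))
      (within (left_region r0 T delta chiL) (locally (0, r0))) (locally (Fv rhoL vL)) ->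
    (forall r, r0 - delta < r < r0 ->
      filterlim (fun t => fT F p Q t r) (at_right 0) (locally (fT F p Q 0 r))) ->
    (forall r, r0 - delta < r < r0 -> fT F p Q 0 r = u0 + (r - r0) * u') ->
    u' = Fr rhoL vL * rr + Fv rhoL vL * vr).
  { intros F Fr Fv u0 u' DF LFr LFv Lt Hdata.
    assert (DT : forall t r, left_region r0 T delta chiL (t, r) -> is_derive (fun s => fT F p Q t s) r
      (Fr (f_rho Q t r) (f_v Q t r) * D2 (f_rho Q) t r + Fv (f_rho Q t r) (f_v Q t r) * D2 (f_v Q) t r)).
    { intros t r Hq.
      destruct (cl_rho _ _ _ _ (of_grp gs_left G) _ Hq) as (_ & R2 & _).
      destruct (cl_v _ _ _ _ (of_grp gs_left G) _ Hq) as (_ & V2 & _).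
      exact (DF (fun s => f_rho Q t s) (fun s => f_v Q t s) r _ _ (Hphys _ _ Hq)
        (Derive_correct _ _ R2) (Derive_correct _ _ V2)). }
    apply (initial_slope (left_region r0 T delta chiL) (fT F p Q) r0 delta u0); try assumption; try lra.
    - intros t r Hq. eexists. now apply DT.
    - apply (filterlim_within_ext _ (fun q =>
        Fr (uncurry (f_rho Q) q) (uncurry (f_v Q) q) * uncurry (D2 (f_rho Q)) q
        + Fv (uncurry (f_rho Q) q) (uncurry (f_v Q) q) * uncurry (D2 (f_v Q)) q)).
      + intros [t r] Hq. symmetry. exact (is_derive_unique _ _ _ (DT t r Hq)).
      + lim_sums. }
  apply primitive_slope_unique; try assumption.
  - apply (HD T00 _ _ (fst UL)); try apply lim_T00_rho; try apply lim_T00_v; try assumption.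
    + apply (is_derive_T00 p Hp).
    + intros r Hr. destruct (H0 r Hr) as (Hq & K1 & K2). now apply lim_T00.
    + intros r Hr. now apply (of_grp gs_dataL G).
  - apply (HD T01 _ _ (snd UL)); try apply lim_T01_rho; try apply lim_T01_v; try assumption.
    + apply (is_derive_T01 p Hp).
    + intros r Hr. destruct (H0 r Hr) as (Hq & K1 & K2). now apply lim_T01.
    + intros r Hr. now apply (of_grp gs_dataL G).
Qed.

End Edges.
End GRP.

(** * The fan in characteristic coordinates *)

Lemma C2_upto_regular (K : R * R -> Prop) f x y : C2_upto K f -> K (x, y) ->
  locally (x, y) (C1_at f) /\ locally (x, y) (C1_at (D1 f)) /\ locally (x, y) (C1_at (D2 f)).
Proof.
  intros Hf HK. generalize (Hf _ HK). intros H.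
  repeat split; revert H; apply filter_imp; intros z; tauto.
Qed.

Lemma mixed_derivatives (K : R * R -> Prop) f (x y : R) : C2_upto K f -> K (x, y) ->
  D1 (D2 f) x y = D2 (D1 f) x y.
Proof.
  intros Hf HK. destruct (C2_upto_regular _ _ _ _ Hf HK) as (L0 & L1 & L2).
  apply (Schwarz f x y).
  - apply locally_2d_locally. generalize (filter_and _ _ L0 (filter_and _ _ L1 L2)).
    apply filter_imp. intros [u v] ((E1 & E2 & _) & (_ & E3 & _) & (E4 & _)). simpl in *. tauto.
  - apply continuity_2d_pt_filterlim. apply (locally_singleton _ _ L2).
  - apply continuity_2d_pt_filterlim. apply (locally_singleton _ _ L1).
Qed.

Section Fan.
Variables (p : R -> R) (kappa r0 : R) (UL UR UL' UR' : R * R) (rhoL vL rhoR vR : R)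
  (wrho wv : R -> R) (rhoS vS sig : R) (Q : flow) (T delta : R) (chiL chiS shock : R -> R)
  (c : fan_chart) (a0 : R).
Hypothesis Hp : eos p.
Let As := f_A Q 0 r0.
Let Bs := f_B Q 0 r0.
Let bL := lam_minus p As Bs rhoL vL.
Let bS := lam_minus p As Bs rhoS vS.
Hypothesis RS : riemann_solution p As Bs rhoL vL rhoR vR wrho wv rhoS vS sig.
Hypothesis G : grp_solution p kappa r0 UL UR UL' UR' rhoL vL rhoR vR wrho wv rhoS vS sig
  Q T delta chiL chiS shock.
Hypothesis FC : fan_coordinates p r0 wrho wv bL bS Q T chiL chiS c a0.

Let K := chart_dom a0 bL bS.

Lemma fan_order : bL < bS < sig.
Proof. exact (of_riemann rs_order RS). Qed.

Lemma a0_neg : a0 < 0.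
Proof. exact (of_fan fc_a0 FC). Qed.

Lemma in_chart a b : a0 < a <= 0 -> bL <= b <= bS -> K (a, b).
Proof. now split. Qed.

Lemma fan_physical b : bL <= b <= bS -> physical (wrho b) (wv b).
Proof. intros Hb. pose proof fan_order. apply (of_riemann rs_phys RS). lra. Qed.

Section Component.
Variable f : R -> R -> R.
Hypothesis Hf : C2_upto K f.
Variables a b : R.
Hypotheses (Ha : a0 < a <= 0) (Hb : bL <= b <= bS).

Lemma component_continuous : continuous (uncurry f) (a, b).
Proof.
  exact (C1_at_continuous _ _ (proj1 (C2_upto_regular K f a b Hf (in_chart _ _ Ha Hb)))).
Qed.

Lemma component_D1 : is_derive (fun x => f x b) a (D1 f a b).
Proof.
  apply Derive_correct. destruct (C2_upto_regular K f a b Hf (in_chart _ _ Ha Hb)) as (L & _).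
  apply (locally_singleton _ _ L).
Qed.

Lemma component_D2 : is_derive (fun y => f a y) b (D2 f a b).
Proof.
  apply Derive_correct. destruct (C2_upto_regular K f a b Hf (in_chart _ _ Ha Hb)) as (L & _).
  apply (locally_singleton _ _ L).
Qed.

Lemma component_D12 : is_derive (fun x => D2 f x b) a (D1 (D2 f) a b).
Proof.
  apply Derive_correct. destruct (C2_upto_regular K f a b Hf (in_chart _ _ Ha Hb)) as (_ & _ & L).
  apply (locally_singleton _ _ L).
Qed.

Lemma component_D21 : is_derive (fun y => D1 f a y) b (D1 (D2 f) a b).
Proof.
  rewrite (mixed_derivatives K f a b Hf (in_chart _ _ Ha Hb)).
  apply Derive_correct. destruct (C2_upto_regular K f a b Hf (in_chart _ _ Ha Hb)) as (_ & L & _).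
  apply (locally_singleton _ _ L).
Qed.

Lemma component_D1_continuous : continuous (uncurry (D1 f)) (a, b).
Proof.
  exact (C1_at_continuous _ _ (proj1 (proj2 (C2_upto_regular K f a b Hf (in_chart _ _ Ha Hb))))).
Qed.

Lemma component_D2_continuous : continuous (uncurry (D2 f)) (a, b).
Proof.
  exact (C1_at_continuous _ _ (proj2 (proj2 (C2_upto_regular K f a b Hf (in_chart _ _ Ha Hb))))).
Qed.

End Component.

(** On the two edges this comes from the position of the bounding curves. *)
Lemma chart_dom_flow a b : a0 < a < 0 -> bL <= b <= bS ->
  0 < c_t c a b /\ dom r0 T delta (c_t c a b, c_r c a b).
Proof.
  intros Ha Hb. destruct (of_fan fc_edges FC a Ha) as (tL & rL & tS & rS).
  destruct (Rle_lt_or_eq_dec _ _ (proj1 Hb)) as [HbL|<-].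
  - destruct (Rle_lt_or_eq_dec _ _ (proj2 Hb)) as [HbS| ->].
    + pose proof (of_fan fc_into FC a b Ha (conj HbL HbS)) as Hin.
      split; [apply (proj1 Hin)|]. exact (of_grp fan_dom G _ Hin).
    + pose proof (of_grp gs_order G _ tS). split; [lra|]. rewrite rS. unfold dom; simpl; lra.
  - pose proof (of_grp gs_order G _ tL). split; [lra|]. rewrite rL. unfold dom; simpl; lra.
Qed.

(* In this section [a] and [b] are the coordinates alpha and beta; [psi_a] and [psi_b] are the
   derivatives of [psi_-] in them, expressed through [d psi_-]. *)
Let source a b := s_minus p kappa (c_A c a b) (c_B c a b) (c_r c a b) (c_rho c a b) (c_v c a b).
Let psi_b a b := coef_a p (c_rho c a b) * D2 (c_rho c) a b + coef_b (c_v c a b) * D2 (c_v c) a b.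
Let psi_a a b := coef_a p (c_rho c a b) * D1 (c_rho c) a b + coef_b (c_v c a b) * D1 (c_v c) a b.

(** The chain rule along [alpha = const], a [lambda_+]-curve, produces the derivative in the
    direction [(1, lambda_+)] scaled by [t_beta], to which the characteristic form applies. *)
Lemma transversal_equation_interior a b : a0 < a < 0 -> bL < b < bS ->
  psi_b a b = source a b * D2 (c_t c) a b.
Proof.
  intros Ha Hb. assert (Hb' : bL <= b <= bS) by lra. assert (Ha' : a0 < a <= 0) by lra.
  pose proof (of_fan fc_into FC a b Ha Hb) as Hin.
  assert (Hopen := of_grp fan_open G _ Hin).
  assert (Near : locally b (fun y => bL <= y <= bS)).
  { generalize (open_and (fun y => bL < y) (fun y => y < bS) (open_gt bL) (open_lt bS) b Hb).
    apply filter_imp. intros y Hy. lra. }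
  assert (DT := component_D2 _ (of_fan fc_t FC) a b Ha' Hb').
  assert (DR := component_D2 _ (of_fan fc_r FC) a b Ha' Hb').
  rewrite (of_fan fc_plus FC a b Ha Hb') in DR.
  assert (E : forall f g, C2_upto K f -> C1_on (between T chiL chiS) g ->
    (forall y, bL <= y <= bS -> f a y = g (c_t c a y) (c_r c a y)) ->
    D2 f a b = D1 g (c_t c a b) (c_r c a b) * D2 (c_t c) a b
      + D2 g (c_t c a b) (c_r c a b) * (clam_plus p c a b * D2 (c_t c) a b)).
  { intros f g Hf Hg Hfg. apply is_derive_unique.
    apply (is_derive_ext_loc (fun y => g (c_t c a y) (c_r c a y))).
    - revert Near. apply filter_imp. intros y Hy. symmetry. now apply Hfg.
    - apply (is_derive_along g (fun y => c_t c a y) (fun y => c_r c a y)); try assumption.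
      revert Hopen. apply filter_imp. exact Hg. }
  pose proof (E _ _ (of_fan fc_rho FC) (cl_rho _ _ _ _ (of_grp gs_fan G))
    (fun y Hy => proj1 (of_fan fc_state FC a y Ha Hy))) as Er.
  pose proof (E _ _ (of_fan fc_v FC) (cl_v _ _ _ _ (of_grp gs_fan G))
    (fun y Hy => proj1 (proj2 (of_fan fc_state FC a y Ha Hy)))) as Ev.
  destruct (of_fan fc_state FC a b Ha Hb') as (S1 & S2 & S3 & S4).
  pose proof (of_grp_eos region_characteristic_form Hp G _
    (of_grp gs_fan G) (of_grp fan_dom G)
    (of_grp fan_open G) _ _ Hin) as Ch.
  unfold psi_b, source. rewrite Er, Ev. unfold clam_plus. rewrite S1, S2, S3, S4, <- Ch.
  unfold flam_plus. ring.
Qed.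

Section Line.
Context {X : Type} (F : (X -> Prop) -> Prop) {FF : Filter F}.
Variables (x y : X -> R) (a b : R).
Hypotheses (Ha : a0 < a <= 0) (Hb : bL <= b <= bS).
Hypotheses (Hx : filterlim (fun z => (x z, y z)) F (locally (a, b))).

Lemma chart_lim f : continuous (uncurry f) (a, b) ->
  filterlim (fun z => f (x z) (y z)) F (locally (f a b)).
Proof. intros Hf. exact (filterlim_comp _ _ _ _ (uncurry f) _ _ _ Hx Hf). Qed.

Hypotheses (Hph : physical (c_rho c a b) (c_v c a b)).

Lemma chart_lim_lam_plus :
  filterlim (fun z => clam_plus p c (x z) (y z)) F (locally (clam_plus p c a b)).
Proof.
  apply lim_lam_plus; try assumption; apply chart_lim, component_continuous; try assumption;
    apply FC.
Qed.

Lemma chart_lim_lam_minus :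
  filterlim (fun z => clam_minus p c (x z) (y z)) F (locally (clam_minus p c a b)).
Proof.
  apply lim_lam_minus; try assumption; apply chart_lim, component_continuous; try assumption;
    apply FC.
Qed.

Lemma chart_lim_source : 0 < c_A c a b -> 0 < c_r c a b ->
  filterlim (fun z => source (x z) (y z)) F (locally (source a b)).
Proof.
  intros HA Hr. apply lim_s_minus; try assumption; apply chart_lim, component_continuous; try assumption;
    apply FC.
Qed.

Lemma chart_lim_psi_b :
  filterlim (fun z => psi_b (x z) (y z)) F (locally (psi_b a b)).
Proof.
  apply lim_plus; [assumption| |]; apply lim_mult; try assumption.
  - apply (lim_coef_a p Hp F _ _ (c_v c a b)); [|assumption].
    apply chart_lim, component_continuous; try assumption; apply FC.
  - apply chart_lim, component_D2_continuous; try assumption; apply FC.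
  - apply (lim_coef_b p Hp F (fun z => c_v c (x z) (y z)) (c_rho c a b)); [|assumption].
    apply chart_lim, component_continuous; try assumption; apply FC.
  - apply chart_lim, component_D2_continuous; try assumption; apply FC.
Qed.

End Line.

Lemma vertical_path (a b : R) : filterlim (fun y => (a, y)) (locally b) (locally (a, b)).
Proof.
  intros P [e He]. exists e. intros y Hy. apply He. split; [apply ball_center|exact Hy].
Qed.

Lemma horizontal_path (a b : R) : filterlim (fun x => (x, b)) (at_left a) (locally (a, b)).
Proof.
  intros P [e He]. exists e. intros x Hx _. apply He. split; [exact Hx|apply ball_center].
Qed.

Lemma transversal_equation a b : a0 < a < 0 -> bL <= b <= bS ->
  psi_b a b = source a b * D2 (c_t c) a b.
Proof.
  intros Ha Hb. assert (Ha' : a0 < a <= 0) by lra. pose proof fan_order.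
  destruct (of_fan fc_state FC a b Ha Hb) as (S1 & S2 & S3 & S4).
  destruct (chart_dom_flow a b Ha Hb) as [_ HD].
  pose proof (of_grp gs_phys G _ _ HD) as Hph. pose proof (of_grp gs_metric G _ _ HD) as (HA & _).
  pose proof (of_grp dom_r_pos G _ _ HD) as Hr.
  rewrite <- S1, <- S2 in Hph. rewrite <- S3 in HA.
  apply (eq_on_closed_segment (fun y => psi_b a y) (fun y => source a y * D2 (c_t c) a y) bL bS);
    [lra|assumption| | |].
  - intros y Hy. now apply transversal_equation_interior.
  - apply chart_lim_psi_b; try assumption; [apply locally_filter|apply vertical_path].
  - apply lim_mult; [apply locally_filter| |].
    + apply chart_lim_source; try assumption; [apply locally_filter|apply vertical_path].
    + apply (chart_lim _ (fun _ => a) (fun y => y) a b); [apply vertical_path|].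
      apply component_D2_continuous; try assumption. apply FC.
Qed.

(** ** The singular point *)

Section Origin.
Variable b : R.
Hypothesis Hb : bL <= b <= bS.

Lemma zero_in_range : a0 < 0 <= 0.
Proof. pose proof a0_neg. lra. Qed.

Lemma origin_physical : physical (c_rho c 0 b) (c_v c 0 b).
Proof. destruct (of_fan fc_origin_state FC b Hb) as [-> ->]. now apply fan_physical. Qed.

Lemma origin_source :
  source 0 b = s_minus p kappa As Bs r0 (wrho b) (wv b).
Proof.
  destruct (of_fan fc_origin_state FC b Hb) as [E1 E2]. destruct (of_fan fc_origin_metric FC b Hb) as [E3 E4].
  destruct (of_fan fc_origin FC b Hb) as [_ E5]. unfold source. now rewrite E1, E2, E3, E4, E5.
Qed.

Lemma origin_lam_plus : clam_plus p c 0 b = lam_plus p As Bs (wrho b) (wv b).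
Proof.
  destruct (of_fan fc_origin_state FC b Hb) as [E1 E2]. destruct (of_fan fc_origin_metric FC b Hb) as [E3 E4].
  unfold clam_plus. now rewrite E1, E2, E3, E4.
Qed.

Lemma origin_lam_minus : clam_minus p c 0 b = b.
Proof.
  destruct (of_fan fc_origin_state FC b Hb) as [E1 E2]. destruct (of_fan fc_origin_metric FC b Hb) as [E3 E4].
  unfold clam_minus. rewrite E1, E2, E3, E4. now apply (of_riemann rs_fan_speed RS).
Qed.

(** All the [lambda_-]-curves start at the same point. *)
Lemma origin_time_b : D2 (c_t c) 0 b = 0.
Proof.
  pose proof fan_order.
  apply (is_derive_eq_on_segment (fun y => c_t c 0 y) (fun _ => 0) bL bS b); [lra|assumption| | |].
  - intros y Hy. now apply (of_fan fc_origin FC).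
  - apply component_D2; [apply FC|apply zero_in_range|assumption].
  - exact (is_derive_const 0 b).
Qed.

(** The first-order form of [beta] being the initial slope: the limit of
    [r_alpha = lambda_- t_alpha]. *)
Lemma origin_ray : D1 (c_r c) 0 b = b * D1 (c_t c) 0 b.
Proof.
  pose proof origin_physical as Hph. pose proof zero_in_range as Hz.
  assert (FL : Filter (at_left 0)) by apply at_left_proper_filter.
  apply (filterlim_locally_unique (F := at_left 0) (fun a => D1 (c_r c) a b)).
  - apply (chart_lim _ (fun a => a) (fun _ => b) 0 b); [apply horizontal_path|].
    apply component_D1_continuous; try assumption. apply FC.
  - apply (filterlim_ext_loc (fun a => clam_minus p c a b * D1 (c_t c) a b)).
    + generalize (at_left_segment _ a0_neg). apply filter_imp. intros a Ha. symmetry.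
      now apply (of_fan fc_minus FC).
    + apply lim_mult; [assumption| |].
      * pose proof (chart_lim_lam_minus (at_left 0) (fun a => a) (fun _ => b) 0 b Hz Hb
          (horizontal_path 0 b) Hph) as L.
        rewrite origin_lam_minus in L. exact L.
      * apply (chart_lim _ (fun a => a) (fun _ => b) 0 b); [apply horizontal_path|].
        apply component_D1_continuous; try assumption. apply FC.
Qed.

End Origin.

Let gap b := lam_plus p As Bs (wrho b) (wv b) - lam_minus p As Bs (wrho b) (wv b).
Let tau b := D1 (c_t c) 0 b.
Let src b := s_minus p kappa As Bs r0 (wrho b) (wv b).

Lemma metric_pos : 0 < As /\ 0 < Bs.
Proof. exact (of_grp corner_metric_pos G). Qed.

Lemma gap_pos b : bL <= b <= bS -> 0 < gap b.
Proof. intros Hb. apply lam_gap_pos; [assumption|apply metric_pos|apply metric_pos|now apply fan_physical]. Qed.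

(** Differentiating [r_alpha = lambda_- t_alpha] in [beta] and [r_beta = lambda_+ t_beta] in
    [alpha] at the singular point, where [t_beta = 0] and [lambda_- = beta], gives two
    expressions for the mixed derivative of [r]. *)
Lemma origin_mixed_time b : bL <= b <= bS -> D1 (D2 (c_t c)) 0 b = tau b / gap b.
Proof.
  intros Hb. pose proof zero_in_range as Hz. pose proof fan_order. pose proof (gap_pos b Hb) as Hg.
  assert (FL : Filter (at_left 0)) by apply at_left_proper_filter.
  assert (E1 : D1 (D2 (c_r c)) 0 b = tau b + b * D1 (D2 (c_t c)) 0 b).
  { replace (tau b + _) with (1 * tau b + b * D1 (D2 (c_t c)) 0 b) by ring.
    apply (is_derive_eq_on_segment (fun y => D1 (c_r c) 0 y) (fun y => y * tau y) bL bS b);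
      [lra|assumption| | |].
    - intros y Hy. now apply origin_ray.
    - apply component_D21; try assumption. apply FC.
    - apply (is_derive_mult (fun y => y) tau b 1); [exact (is_derive_id b)| |exact Rmult_comm].
      apply component_D21; try assumption. apply FC. }
  assert (E2 : D1 (D2 (c_r c)) 0 b = clam_plus p c 0 b * D1 (D2 (c_t c)) 0 b).
  { apply (left_derivative_of_product (fun a => D2 (c_r c) a b) (fun a => D2 (c_t c) a b)
      (fun a => clam_plus p c a b) a0 0); [exact a0_neg| | | | |].
    - intros a Ha. now apply (of_fan fc_plus FC).
    - now apply origin_time_b.
    - apply chart_lim_lam_plus; try assumption; [apply horizontal_path|now apply origin_physical].
    - apply component_D12; try assumption. apply FC.
    - apply component_D12; try assumption. apply FC. }
  rewrite origin_lam_plus in E2 by assumption.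
  unfold gap in *. rewrite (of_riemann rs_fan_speed RS b Hb) in *.
  rewrite E1 in E2. apply (Rmult_eq_reg_r (lam_plus p As Bs (wrho b) (wv b) - b)); [|lra].
  transitivity (tau b); [lra|field; lra].
Qed.

(** The [beta]-derivative of [psi_alpha] is the [alpha]-derivative of [psi_beta], by the
    symmetry of the mixed derivatives of [rho] and [v]; the latter is obtained by dividing the
    transversal equation by [alpha]. *)
Lemma origin_psi_a_derivative b : bL <= b <= bS ->
  is_derive (fun y => psi_a 0 y) b (tau b * src b / gap b).
Proof.
  intros Hb. pose proof zero_in_range as Hz. pose proof (gap_pos b Hb) as Hg.
  pose proof (origin_physical b Hb) as Hph.
  assert (Hr : 0 < r0).
  { exact (of_grp dom_r_pos G _ _
      (of_grp corner_in_dom G)). }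
  pose proof (Derive_correct _ _ (ex_derive_coef_a p Hp _ (proj1 Hph))) as Da.
  pose proof (Derive_correct _ _ (ex_derive_coef_b _ (proj2 Hph))) as Db.
  set (a' := Derive (coef_a p) (c_rho c 0 b)) in *. set (b' := Derive coef_b (c_v c 0 b)) in *.
  set (mixed := (D1 (c_rho c) 0 b * a' * D2 (c_rho c) 0 b + coef_a p (c_rho c 0 b) * D1 (D2 (c_rho c)) 0 b)
    + (D1 (c_v c) 0 b * b' * D2 (c_v c) 0 b + coef_b (c_v c 0 b) * D1 (D2 (c_v c)) 0 b)).
  assert (Crho := of_fan fc_rho FC). assert (Cv := of_fan fc_v FC).
  assert (E1 : is_derive (fun x => psi_b x b) 0 mixed).
  { apply (is_derive_plus (fun x => coef_a p (c_rho c x b) * D2 (c_rho c) x b)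
      (fun x => coef_b (c_v c x b) * D2 (c_v c) x b)).
    - apply (is_derive_mult (fun x => coef_a p (c_rho c x b)) (fun x => D2 (c_rho c) x b));
        [|now apply component_D12|exact Rmult_comm].
      apply (is_derive_comp (coef_a p) (fun x => c_rho c x b)); [assumption|now apply component_D1].
    - apply (is_derive_mult (fun x => coef_b (c_v c x b)) (fun x => D2 (c_v c) x b));
        [|now apply component_D12|exact Rmult_comm].
      apply (is_derive_comp coef_b (fun x => c_v c x b)); [assumption|now apply component_D1]. }
  assert (E2 : is_derive (fun y => psi_a 0 y) b mixed).
  { replace mixed with ((D2 (c_rho c) 0 b * a' * D1 (c_rho c) 0 b + coef_a p (c_rho c 0 b) * D1 (D2 (c_rho c)) 0 b)
    + (D2 (c_v c) 0 b * b' * D1 (c_v c) 0 b + coef_b (c_v c 0 b) * D1 (D2 (c_v c)) 0 b))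
      by (unfold mixed; ring).
    apply (is_derive_plus (fun y => coef_a p (c_rho c 0 y) * D1 (c_rho c) 0 y)
      (fun y => coef_b (c_v c 0 y) * D1 (c_v c) 0 y)).
    - apply (is_derive_mult (fun y => coef_a p (c_rho c 0 y)) (fun y => D1 (c_rho c) 0 y));
        [|now apply component_D21|exact Rmult_comm].
      apply (is_derive_comp (coef_a p) (fun y => c_rho c 0 y)); [assumption|now apply component_D2].
    - apply (is_derive_mult (fun y => coef_b (c_v c 0 y)) (fun y => D1 (c_v c) 0 y));
        [|now apply component_D21|exact Rmult_comm].
      apply (is_derive_comp coef_b (fun y => c_v c 0 y)); [assumption|now apply component_D2]. }
  replace (tau b * src b / gap b) with mixed; [assumption|].
  transitivity (source 0 b * D1 (D2 (c_t c)) 0 b).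
  - apply (left_derivative_of_product (fun a => psi_b a b) (fun a => D2 (c_t c) a b)
      (fun a => source a b) a0 0); [exact a0_neg| | | |assumption|].
    + intros a Ha. now apply transversal_equation.
    + now apply origin_time_b.
    + apply chart_lim_source; try assumption; [apply at_left_proper_filter|apply horizontal_path| |].
      * rewrite (proj1 (of_fan fc_origin_metric FC b Hb)). apply metric_pos.
      * now rewrite (proj2 (of_fan fc_origin FC b Hb)).
    + apply component_D12; try assumption. apply FC.
  - rewrite origin_mixed_time, origin_source by assumption. fold (src b). field. lra.
Qed.

(** ** Integration across the fan *)

(** On the leading edge [alpha] measures [r], hence [r_alpha = 1]. *)
Lemma tau_bL : bL * tau bL = 1.
Proof.
  pose proof fan_order. pose proof zero_in_range as Hz. assert (HbL : bL <= bL <= bS) by lra.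
  unfold tau. rewrite <- origin_ray by assumption.
  apply (is_derive_eq_on_segment (fun a => c_r c a bL) (fun a => r0 + a) (a0 / 2) 0 0); [lra|lra| | |].
  - intros y Hy. destruct (Req_dec y 0) as [->|Hy0].
    + rewrite (proj2 (of_fan fc_origin FC bL HbL)). ring.
    + apply (of_fan fc_alpha FC). lra.
  - apply component_D1; try assumption. apply FC.
  - auto_derive; [trivial|ring].
Qed.

Lemma tau_nonpos b : bL <= b <= bS -> tau b <= 0.
Proof.
  intros Hb. pose proof zero_in_range as Hz.
  apply Rnot_lt_le. intros Hpos.
  pose proof (left_quotient _ _ _ (component_D1 _ (of_fan fc_t FC) 0 b Hz Hb)) as L.
  generalize (filter_and _ _ (at_left_segment _ a0_neg) (L (fun z => 0 < z) (open_gt 0 _ Hpos))).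
  intros HN. destruct (filter_ex _ HN) as (a & Ha & Hq).
  rewrite (proj1 (of_fan fc_origin FC b Hb)), !Rminus_0_r in Hq.
  destruct (chart_dom_flow a b Ha Hb) as [Ht _].
  assert (/ a < 0) by (apply Rinv_lt_0_compat; lra). unfold Rdiv in Hq. nra.
Qed.

Lemma is_derive_tau b : bL <= b <= bS -> is_derive tau b (tau b / gap b).
Proof.
  intros Hb. rewrite <- origin_mixed_time by assumption.
  apply component_D21; [apply FC|apply zero_in_range|assumption].
Qed.

(** [t > 0 = t(0, .)] for [alpha < 0] makes [t_alpha <= 0]; it does not vanish on the leading
    edge, and by its differential equation it decreases from there. *)
Lemma tau_neg b : bL <= b <= bS -> tau b < 0.
Proof.
  intros Hb. pose proof fan_order. assert (HbL : bL <= bL <= bS) by lra.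
  assert (H0 : tau bL < 0).
  { destruct (tau_nonpos bL HbL) as [Hn|Hn]; [assumption|].
    pose proof tau_bL as E. rewrite Hn in E. lra. }
  destruct (MVT_gen tau bL b (fun x => tau x / gap x)) as (x & Hx & E).
  - rewrite Rmin_left, Rmax_right by lra. intros x Hx. apply is_derive_tau. lra.
  - rewrite Rmin_left, Rmax_right by lra. intros x Hx. apply continuity_pt_filterlim.
    apply (is_derive_continuous tau x (tau x / gap x)), is_derive_tau. lra.
  - rewrite Rmin_left, Rmax_right in Hx by lra.
    assert (Hx' : bL <= x <= bS) by lra.
    pose proof (tau_nonpos x Hx'). pose proof (Rinv_0_lt_compat _ (gap_pos x Hx')).
    assert (tau x / gap x <= 0) by (unfold Rdiv; nra). nra.
Qed.

Lemma continuous_fan b : bL <= b <= bS -> continuous gap b /\ continuous src b.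
Proof.
  intros Hb. destruct (of_riemann rs_cont RS b Hb) as [C1 C2]. pose proof (fan_physical b Hb) as Hph.
  split.
  - apply lim_minus; [apply locally_filter| |].
    + apply lim_lam_plus; try assumption; first [apply locally_filter|apply filterlim_const].
    + apply lim_lam_minus; try assumption; first [apply locally_filter|apply filterlim_const].
  - apply lim_s_minus; try assumption;
      first [apply locally_filter|apply filterlim_const|apply metric_pos|idtac].
    exact (of_grp dom_r_pos G _ _
      (of_grp corner_in_dom G)).
Qed.

(** The logarithmic derivative of [t_alpha (0, .)] is [1 / gap]. *)
Lemma exp_gap_integral b : bL <= b <= bS ->
  exp (- RInt (fun w => 1 / gap w) b bS) = tau b / tau bS.
Proof.
  intros Hb. pose proof fan_order. assert (HbS : bL <= bS <= bS) by lra.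
  pose proof (tau_neg b Hb) as Hn. pose proof (tau_neg bS HbS) as HnS.
  assert (E : RInt (fun w => 1 / gap w) b bS = ln (- tau bS) - ln (- tau b)).
  { apply is_RInt_unique. apply (is_RInt_derive (fun w => ln (- tau w))).
    - rewrite Rmin_left, Rmax_right by lra. intros x Hx. assert (Hx' : bL <= x <= bS) by lra.
      pose proof (is_derive_tau x Hx') as Dt. pose proof (tau_neg x Hx'). pose proof (gap_pos x Hx').
      auto_derive; [split; [eexists; exact Dt|split; [lra|trivial]]|].
      replace (Derive (fun y : R => tau y) x) with (tau x / gap x)
        by (symmetry; exact (is_derive_unique _ _ _ Dt)).
      field. lra.
    - rewrite Rmin_left, Rmax_right by lra. intros x Hx. assert (Hx' : bL <= x <= bS) by lra.
      apply lim_div; [apply locally_filter|apply Rgt_not_eq, gap_pos, Hx'|apply filterlim_const|].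
      now apply continuous_fan. }
  rewrite E. replace (- (ln (- tau bS) - ln (- tau b))) with (ln (- tau b) - ln (- tau bS)) by ring.
  rewrite <- ln_div by lra. rewrite exp_ln by (apply Rdiv_lt_0_compat; lra). field. lra.
Qed.

(** Variation of constants: [psi_alpha / t_alpha (0, beta_S)] is a primitive of the integrand. *)
Lemma fan_integral :
  psi_a 0 bS / tau bS
  = psi_a 0 bL / tau bL * exp (- RInt (fun w => 1 / gap w) bL bS)
    + RInt (fun b => src b / gap b * exp (- RInt (fun w => 1 / gap w) b bS)) bL bS.
Proof.
  pose proof fan_order. assert (HbS : bL <= bS <= bS) by lra. assert (HbL : bL <= bL <= bS) by lra.
  pose proof (tau_neg _ HbS) as HnS. pose proof (tau_neg _ HbL) as HnL.
  rewrite exp_gap_integral by assumption.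
  rewrite (RInt_ext _ (fun b => src b / gap b * (tau b / tau bS))).
  2:{ rewrite Rmin_left, Rmax_right by lra. intros x Hx. f_equal. apply exp_gap_integral. lra. }
  assert (E : RInt (fun b => src b / gap b * (tau b / tau bS)) bL bS
    = psi_a 0 bS / tau bS - psi_a 0 bL / tau bS).
  { apply is_RInt_unique. apply (is_RInt_derive (fun b => psi_a 0 b / tau bS)).
    - rewrite Rmin_left, Rmax_right by lra. intros x Hx. assert (Hx' : bL <= x <= bS) by lra.
      pose proof (origin_psi_a_derivative x Hx') as Dp. pose proof (gap_pos x Hx').
      auto_derive; [eexists; exact Dp|].
      replace (Derive (fun y : R => psi_a 0 y) x) with (tau x * src x / gap x)
        by (symmetry; exact (is_derive_unique _ _ _ Dp)).
      field. lra.
    - rewrite Rmin_left, Rmax_right by lra. intros x Hx. assert (Hx' : bL <= x <= bS) by lra.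
      destruct (continuous_fan x Hx') as [Cg Cs]. pose proof (gap_pos x Hx') as Hg.
      assert (FL : Filter (locally x)) by apply locally_filter.
      apply lim_mult; [assumption| |].
      + apply lim_div; try assumption. lra.
      + apply lim_div; try assumption; [lra| |apply filterlim_const].
        exact (is_derive_continuous _ _ _ (is_derive_tau x Hx')). }
  rewrite E. field. lra.
Qed.

(** ** Matching with the adjacent regions *)

Lemma left_state : wrho bL = rhoL /\ wv bL = vL.
Proof. apply (of_riemann rs_left RS). apply Rle_refl. Qed.

Lemma mid_state : wrho bS = rhoS /\ wv bS = vS.
Proof. pose proof fan_order. apply (of_riemann rs_mid RS). fold bS. lra. Qed.

Lemma left_physical : physical rhoL vL.
Proof.
  pose proof fan_order. destruct left_state as [E1 E2].
  rewrite <- E1, <- E2. apply fan_physical. lra.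
Qed.

Lemma mid_physical : physical rhoS vS.
Proof.
  pose proof fan_order. destruct mid_state as [E1 E2].
  rewrite <- E1, <- E2. apply fan_physical. lra.
Qed.

Lemma psi_a_left rt rr vt vr :
  tends (left_region r0 T delta chiL) (D1 (f_rho Q)) (0, r0) rt ->
  tends (left_region r0 T delta chiL) (D2 (f_rho Q)) (0, r0) rr ->
  tends (left_region r0 T delta chiL) (D1 (f_v Q)) (0, r0) vt ->
  tends (left_region r0 T delta chiL) (D2 (f_v Q)) (0, r0) vr ->
  psi_a 0 bL = tau bL * (coef_a p rhoL * rt + coef_b vL * vt
                         + bL * (coef_a p rhoL * rr + coef_b vL * vr)).
Proof.
  intros Lrt Lrr Lvt Lvr. pose proof fan_order. pose proof zero_in_range as Hz.
  assert (Hb : bL <= bL <= bS) by lra.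
  assert (E : forall f g l1 l2, C2_upto K f -> C1_on (left_region r0 T delta chiL) g ->
    (forall a, a0 < a < 0 -> f a bL = g (c_t c a bL) (c_r c a bL)) ->
    (forall t, 0 < t < T -> continuous (uncurry g) (t, chiL t)) ->
    tends (left_region r0 T delta chiL) (D1 g) (0, r0) l1 ->
    tends (left_region r0 T delta chiL) (D2 g) (0, r0) l2 ->
    D1 f 0 bL = tau bL * (l1 + bL * l2)).
  { intros f g l1 l2 Hf Hg Hfg Cg L1 L2.
    apply (of_grp_eos left_edge_chart_derivative Hp G
      left_physical g l1 l2 a0 (tau bL) (D1 f 0 bL) (fun a => c_t c a bL) (fun a => f a bL));
      try assumption.
    - exact a0_neg.
    - now apply (of_fan fc_origin FC).
    - apply component_D1; try assumption. apply FC.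
    - now apply component_D1.
    - intros a Ha. destruct (of_fan fc_edges FC a Ha) as (H1 & H2 & _).
      split; [lra|]. now rewrite <- H2, Hfg. }
  assert (Er : D1 (c_rho c) 0 bL = tau bL * (rt + bL * rr)).
  { apply (E _ (f_rho Q)); try assumption; [apply FC|apply (of_grp gs_left G)| |].
    - intros a Ha. now apply (of_fan fc_state FC).
    - intros t Ht. apply (of_grp continuous_left_edge G t Ht). }
  assert (Ev : D1 (c_v c) 0 bL = tau bL * (vt + bL * vr)).
  { apply (E _ (f_v Q)); try assumption; [apply FC|apply (of_grp gs_left G)| |].
    - intros a Ha. now apply (of_fan fc_state FC).
    - intros t Ht. apply (of_grp continuous_left_edge G t Ht). }
  unfold psi_a. destruct (of_fan fc_origin_state FC bL Hb) as [-> ->]. destruct left_state as [-> ->].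
  rewrite Er, Ev. ring.
Qed.

Lemma psi_a_mid rt rr vt vr :
  tends (between T chiS shock) (D1 (f_rho Q)) (0, r0) rt ->
  tends (between T chiS shock) (D2 (f_rho Q)) (0, r0) rr ->
  tends (between T chiS shock) (D1 (f_v Q)) (0, r0) vt ->
  tends (between T chiS shock) (D2 (f_v Q)) (0, r0) vr ->
  psi_a 0 bS = tau bS * (coef_a p rhoS * rt + coef_b vS * vt
                         + bS * (coef_a p rhoS * rr + coef_b vS * vr)).
Proof.
  intros Lrt Lrr Lvt Lvr. pose proof fan_order. pose proof zero_in_range as Hz.
  assert (Hb : bL <= bS <= bS) by lra.
  assert (E : forall f g l1 l2, C2_upto K f -> C1_on (between T chiS shock) g ->
    (forall a, a0 < a < 0 -> f a bS = g (c_t c a bS) (c_r c a bS)) ->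
    (forall t, 0 < t < T -> continuous (uncurry g) (t, chiS t)) ->
    tends (between T chiS shock) (D1 g) (0, r0) l1 ->
    tends (between T chiS shock) (D2 g) (0, r0) l2 ->
    D1 f 0 bS = tau bS * (l1 + bS * l2)).
  { intros f g l1 l2 Hf Hg Hfg Cg L1 L2.
    apply (of_grp_eos mid_edge_chart_derivative Hp G
      mid_physical g l1 l2 a0 (tau bS) (D1 f 0 bS) (fun a => c_t c a bS) (fun a => f a bS));
      try assumption.
    - exact a0_neg.
    - now apply (of_fan fc_origin FC).
    - apply component_D1; try assumption. apply FC.
    - now apply component_D1.
    - intros a Ha. destruct (of_fan fc_edges FC a Ha) as (_ & _ & H1 & H2).
      split; [lra|]. now rewrite <- H2, Hfg. }
  assert (Er : D1 (c_rho c) 0 bS = tau bS * (rt + bS * rr)).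
  { apply (E _ (f_rho Q)); try assumption; [apply FC|apply (of_grp gs_mid G)| |].
    - intros a Ha. now apply (of_fan fc_state FC).
    - intros t Ht. apply (of_grp continuous_mid_edge G t Ht). }
  assert (Ev : D1 (c_v c) 0 bS = tau bS * (vt + bS * vr)).
  { apply (E _ (f_v Q)); try assumption; [apply FC|apply (of_grp gs_mid G)| |].
    - intros a Ha. now apply (of_fan fc_state FC).
    - intros t Ht. apply (of_grp continuous_mid_edge G t Ht). }
  unfold psi_a. destruct (of_fan fc_origin_state FC bS Hb) as [-> ->]. destruct mid_state as [-> ->].
  rewrite Er, Ev. ring.
Qed.

(** [psi_alpha / t_alpha] at either end of the fan is the rate of change of the invariant in
    the [lambda_-]-direction in the adjacent region. *)
Lemma rate_across_fan rtL rrL vtL vrL rtS rrS vtS vrS :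
  tends (left_region r0 T delta chiL) (D1 (f_rho Q)) (0, r0) rtL ->
  tends (left_region r0 T delta chiL) (D2 (f_rho Q)) (0, r0) rrL ->
  tends (left_region r0 T delta chiL) (D1 (f_v Q)) (0, r0) vtL ->
  tends (left_region r0 T delta chiL) (D2 (f_v Q)) (0, r0) vrL ->
  tends (between T chiS shock) (D1 (f_rho Q)) (0, r0) rtS ->
  tends (between T chiS shock) (D2 (f_rho Q)) (0, r0) rrS ->
  tends (between T chiS shock) (D1 (f_v Q)) (0, r0) vtS ->
  tends (between T chiS shock) (D2 (f_v Q)) (0, r0) vrS ->
  coef_a p rhoS * rtS + coef_b vS * vtS + bS * (coef_a p rhoS * rrS + coef_b vS * vrS)
  = (coef_a p rhoL * rtL + coef_b vL * vtL + bL * (coef_a p rhoL * rrL + coef_b vL * vrL))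
    * exp (- RInt (fun w => 1 / gap w) bL bS)
    + RInt (fun b => src b / gap b * exp (- RInt (fun w => 1 / gap w) b bS)) bL bS.
Proof.
  intros L1 L2 L3 L4 S1 S2 S3 S4. pose proof fan_order.
  assert (HnL : tau bL < 0) by (apply tau_neg; lra).
  assert (HnS : tau bS < 0) by (apply tau_neg; lra).
  pose proof fan_integral as E.
  rewrite (psi_a_left _ _ _ _ L1 L2 L3 L4), (psi_a_mid _ _ _ _ S1 S2 S3 S4) in E.
  assert (Cancel : forall t x, t < 0 -> t * x / t = x) by (intros t x Ht; field; lra).
  rewrite !Cancel in E by assumption.
  exact E.
Qed.

End Fan.

(** * The transition formula *)

(** The coefficients of [d psi_-] form a left eigenvector of [J] for [lambda_+], so the terms
    [H - J V_r] contract to [s_- - lambda_+ Y]. *)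
Lemma Dminus_psi_minus_data_eq p kappa A B r rho v U' rr vr : eos p -> physical rho v ->
  primitive_slope p rho v U' = (rr, vr) ->
  Dminus_psi_minus_data p kappa A B r rho v U'
  = s_minus p kappa A B r rho v
    - (lam_plus p A B rho v - lam_minus p A B rho v) * (coef_a p rho * rr + coef_b v * vr).
Proof.
  intros Hp Hph E. unfold Dminus_psi_minus_data. rewrite E. simpl fst. simpl snd.
  destruct (physical_bounds p Hp _ _ Hph) as (HE & Hn & Hm & Hq & Hd).
  unfold s_minus. set (h1 := H1 p kappa A B r rho v). set (h2 := H2 p kappa A B r rho v).
  unfold Jdiag, J12, J21, Jpref, lam_plus, lam_minus, coef_a, coef_b.
  set (cc := cs p rho) in *. field. repeat split; nra.
Qed.

Theorem theorem3p1 (p : R -> R) (kappa r0 rho_ref : R)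
    (UL UR UL' UR' : R * R) (rhoL vL rhoR vR rhoS vS sig As Bs : R)
    (wrho wv : R -> R)
    (Q : flow) (T delta : R) (chiL chiS shock : R -> R)
    (c : fan_chart) (a0 rhot vt : R) :
  eos p -> 0 < kappa -> 0 < r0 -> 0 < rho_ref ->
  physical rhoL vL -> consU p rhoL vL = UL ->
  physical rhoR vR -> consU p rhoR vR = UR ->
  f_A Q 0 r0 = As -> f_B Q 0 r0 = Bs ->
  riemann_solution p As Bs rhoL vL rhoR vR wrho wv rhoS vS sig ->
  grp_solution p kappa r0 UL UR UL' UR' rhoL vL rhoR vR wrho wv rhoS vS sig
    Q T delta chiL chiS shock ->
  fan_coordinates p r0 wrho wv
    (lam_minus p As Bs rhoL vL) (lam_minus p As Bs rhoS vS) Q T chiL chiS c a0 ->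
  tends (between T chiS shock) (D1 (f_rho Q)) (0, r0) rhot ->
  tends (between T chiS shock) (D1 (f_v Q)) (0, r0) vt ->
  let DL := Dminus_psi_minus_data p kappa As Bs r0 rhoL vL UL' in
  tends (left_region r0 T delta chiL) (Dminus_psi_minus p rho_ref Q) (0, r0) DL /\
  coef_a p rhoS * rhot + coef_b vS * vt
    = coef_d p kappa As Bs r0 DL rhoL vL rhoS vS wrho wv.
Proof.
  intros Hp _ _ Href HphL _ _ _ <- <- RS G FC Lrt Lvt DL.
  pose proof (of_riemann mid_physical RS) as HphS.
  destruct (of_grp gs_left_lim G)
    as (LrL & LvL & (rtL & LrtL) & (rrL & LrrL) & (vtL & LvtL) & (vrL & LvrL)).
  destruct (of_grp gs_mid_lim G)
    as (Lr & Lv & _ & (rr & Lrr) & _ & (vr & Lvr)).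
  pose proof (of_grp edge_order G) as Ord.
  destruct (of_grp left_inner_curve G) as (tau & Htau & Hin).
  assert (ChL := of_grp_eos corner_characteristic_form Hp G
    (left_region r0 T delta chiL)).
  specialize (ChL (of_grp gs_left G)
    (of_grp left_dom G)
    (of_grp left_open G)
    (fun t => chiL t - t) tau rhoL vL rtL rrL vtL vrL).
  assert (ChS := of_grp_eos corner_characteristic_form Hp G
    (between T chiS shock)).
  specialize (ChS (of_grp gs_mid G)
    (of_grp mid_dom G)
    (of_grp mid_open G)
    (fun t => (chiS t + shock t) / 2) T rhoS vS rhot rr vt vr).
  assert (LchiL := of_grp gs_chiL0 G).
  assert (LchiS := of_grp gs_chiS0 G).
  assert (Lshock := of_grp gs_shock0 G).
  assert (HT := of_grp gs_T G).
  assert (FR : Filter (at_right 0)) by apply at_right_proper_filter.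
  assert (EL : coef_a p rhoL * rtL + coef_b vL * vtL
    + lam_minus p (f_A Q 0 r0) (f_B Q 0 r0) rhoL vL * (coef_a p rhoL * rrL + coef_b vL * vrL) = DL).
  { unfold DL. erewrite Dminus_psi_minus_data_eq; [|assumption|assumption|].
    2:{ exact (of_grp_eos left_slopes Hp G HphL rrL vrL LrrL LvrL). }
    rewrite <- ChL; try assumption; [ring|lra| |].
    - rewrite <- (Rminus_0_r r0). apply lim_minus; [assumption|assumption|exact lim_time].
    - intros t Ht. pose proof (Hin t Ht). split; simpl; lra. }
  split.
  - rewrite <- EL.
    apply (of_grp_eos tends_Dminus_psi_minus Hp G); try assumption.
    + exact (of_grp gs_left G).
    + exact (of_grp left_dom G).
  - pose proof (rate_across_fan _ _ _ _ _ _ _ _ _ _ _ _ _ _ _ _ _ _ _ _ _ _ _ _ Hp RS G FC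
      rtL rrL vtL vrL rhot rr vt vr LrtL LrrL LvtL LvrL Lrt Lrr Lvt Lvr) as E.
    rewrite EL in E.
    pose proof (of_grp metric_pos G) as [HA HB].
    pose proof (lam_gap_pos p Hp _ _ _ _ HA HB HphS) as Hgap.
    assert (ES : coef_a p rhoS * rhot + coef_b vS * vt
      + lam_plus p (f_A Q 0 r0) (f_B Q 0 r0) rhoS vS * (coef_a p rhoS * rr + coef_b vS * vr)
      = s_minus p kappa (f_A Q 0 r0) (f_B Q 0 r0) r0 rhoS vS).
    { apply ChS; try assumption.
      - replace r0 with ((r0 + r0) / 2) by field.
        apply lim_div; [assumption|lra|now apply lim_plus|apply filterlim_const].
      - intros t Ht. pose proof (Ord t Ht). split; simpl; lra. }
    unfold coef_d. rewrite <- ES.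
    set (lp := lam_plus p (f_A Q 0 r0) (f_B Q 0 r0) rhoS vS) in *.
    set (lm := lam_minus p (f_A Q 0 r0) (f_B Q 0 r0) rhoS vS) in *.
    cbv zeta.
    match type of E with _ = DL * ?x + ?i =>
      transitivity (lp / (lp - lm) * (DL * x + i) - lm * (coef_a p rhoS * rhot + coef_b vS * vt
        + lp * (coef_a p rhoS * rr + coef_b vS * vr)) / (lp - lm)); [rewrite <- E; field; lra|ring]
    end.
Qed.
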